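(* Let $(E,\rho)$ be a Polish space with a fixed point $o\in E$. For any $N\ge 1$ let $(\mathbf X_t^{i,N})_{1\le i\le N}$, $t\ge 0$, be an $E^N$-valued time-homogeneous and continuous Markov process with $\mathscr L_{\mathbf X_t^{i,N}}\in\mathscr P_2(E)$ such that the distribution of $(\mathbf X_t^{i,N})_{1\le i\le N}$ is exchangeable, and let $\{\mathbf P_t^*\}_{t\ge 0}$ be a family of mappings on $\mathscr P_2(E)$ with $\mathbf P_0^*\mu=\mu$ and $\mathbf P_s^*\mathbf P_t^*\mu=\mathbf P_{s+t}^*\mu$ for $\mu\in\mathscr P_2(E)$. Assume that there exist constants $t_0>r_0\ge 0$, $c>0$ and continuous functions $g:[0,\infty)\to(0,\infty)$, $h:(r_0,t_0]\to(0,\infty)$ with $\lim_{t\to\infty}g(t)=0$, $\lim_{t\to r_0}h(t)=\infty$ such that for any $N\ge1$ and $\mu\in\mathscr P_2(E)$, $$\mathrm{Ent}\big(\mathscr L_{(\mathbf X_t^{i,N})_{1\le i\le N}}\,\big|\,(\mathbf P_t^*\mu)^{\otimes N}\big)\le h(t)\,\mathbb W_2\big(\mathscr L_{(\mathbf X_0^{i,N})_{1\le i\le N}},\mu^{\otimes N}\big)^2+c\big(1+\mu(\rho(o,\cdot)^2)\big),\quad t\in(r_0,t_0],$$ $$\mathbb W_2\big(\mathscr L_{(\mathbf X_t^{i,N})_{1\le i\le N}},(\mathbf P_t^*\mu)^{\otimes N}\big)^2\le g(t)\,\mathbb W_2\big(\mathscr L_{(\mathbf X_0^{i,N})_{1\le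 i\le N}},\mu^{\otimes N}\big)^2+c\big(1+\mu(\rho(o,\cdot)^2)\big),\quad t\ge0,$$ and $$\sup_{t\ge0}(\mathbf P_t^*\mu)\big(1+\rho(o,\cdot)^2\big)\le c\big(1+\mu(\rho(o,\cdot)^2)\big).$$ Then the following assertions hold. (i) There exists a constant $\tilde c>0$ such that for any $1\le k\le N<\infty$ and $\mu\in\mathscr P_2(E)$, $$\mathrm{Ent}\big(\mathscr L_{(\mathbf X_t^{i,N})_{1\le i\le k}}\,\big|\,(\mathbf P_t^*\mu)^{\otimes k}\big)\le \tilde c\,\frac kN\,g\big((t-t_0)\vee0\big)\,h(t\wedge t_0)\,\mathbb W_2\big(\mathscr L_{(\mathbf X_0^{i,N})_{1\le i\le N}},\mu^{\otimes N}\big)^2+\tilde c\big(1+\mu(\rho(o,\cdot)^2)\big)\frac kN,\quad t>r_0 .$$ (ii) If $\mathbf P_t^*$ has a unique invariant probability measure $\mu^*\in\mathscr P_2(E)$, then for $1\le k\le N<\infty$, with $\tilde c$ the constant in (i), $$\mathrm{Ent}\big(\mathscr L_{(\mathbf X_t^{i,N})_{1\le i\le k}}\,\big|\,(\mu^* )^{\otimes k}\big)\le \tilde c\,\frac kN\,g\big((t-t_0)\vee0\big)\,h(t\wedge t_0)\,\mathbb W_2\big(\mathscr L_{(\mathbf X_0^{i,N})_{1\le i\le N}},(\mu^* )^{\otimes N}\big)^2+\tilde c\big(1+\mu^*(\rho(o,\cdot)^2)\big)\frac kN,\quad t>r_0 .$$ (iii) If, in addition to the assumption in (ii), for any $N\ge1$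 there exists $\bar\mu^N\in\mathscr P_2(E^N)$ such that $\lim_{t\to\infty}\mathbb W_2(\mathscr L_{(\mathbf X_t^{i,N})_{1\le i\le N}},\bar\mu^N)=0$, then for $1\le k\le N<\infty$, $$\mathrm{Ent}\big(\bar\mu^N\circ\pi_k^{-1}\,\big|\,(\mu^* )^{\otimes k}\big)\le\tilde c\big(1+\mu^*(\rho(o,\cdot)^2)\big)\frac kN,$$ where $\pi_k$ is the projection mapping from $E^N$ to $E^k$ (onto the first $k$ coordinates).
   Context: $\mathscr P(E)$ is the space of probability measures on $E$ with the weak topology; $\mathscr P_2(E)=\{\mu\in\mathscr P(E):\mu(\rho(o,\cdot)^2)<\infty\}$, where $\mu(f)=\int f\,d\mu$. $\mathscr L_\xi$ denotes the law of a random variable $\xi$. $\mu^{\otimes k}$ is the $k$-fold product measure. For $k\ge1$ and $\mu,\nu\in\mathscr P_2(E^k)$, $$\mathbb W_2(\mu,\nu)=\inf_{\pi\in\mathbf C(\mu,\nu)}\Big(\int_{E^k\times E^k}\sum_{i=1}^k\rho(\xi^i,\tilde\xi^i)^2\,\pi(d\xi,d\tilde\xi)\Big)^{1/2},$$ where $\mathbf C(\mu,\nu)$ is the set of couplings of $\mu,\nu$ and $\xi=(\xi^1,\dots,\xi^k)$, $\tilde\xi=(\tilde\xi^1,\dots,\tilde\xi^k)$; $\mathscr P_2(E^k)$ consists of the probability measures on $E^k$ with $\int\sum_{i=1}^k\rho(o,\xi^i)^2\,\mu(d\xi)<\infty$. The relative entropy is $\mathrm{Ent}(\nu|\mu)=\nu(\log\frac{d\nu}{d\mu})$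 if $\nu\ll\mu$ and $+\infty$ otherwise. A measure $\mu^*\in\mathscr P_2(E)$ is invariant for $\mathbf P_t^*$ if $\mathbf P_t^*\mu^*=\mu^*$ for all $t\ge0$.
   Formalization: The entropy and Wasserstein bounds are assumed, and (i)–(iii) proved, for all realisations of the Markov process with exchangeable laws and marginals in P_2(E), whatever the initial law; for one process with a fixed initial law the claim can fail for t > t_0. *)

(* Defs.v *)
From HB Require Import structures.
From mathcomp Require Import all_boot all_order all_algebra all_fingroup.
From mathcomp Require Import all_classical all_reals all_analysis.

Set Implicit Arguments.
Unset Strict Implicit.
Unset Printing Implicit Defensive.

Import Order.TTheory GRing.Theory Num.Theory.
Import numFieldNormedType.Exports.

Local Open Scope classical_set_scope.
Local Open Scope ring_scope.
Local Open Scope ereal_scope.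

(* A separable complete metric space with its Borel sigma-algebra. *)
HB.mixin Record isPolish d (R : realType) (E : Type)
    & Metric R E & Complete E & Measurable d E := {
  polish_separable : exists2 D : set E, countable D & dense D ;
  polish_borel : @measurable d E = <<s [set U : set E | open U] >> }.

#[short(type="polishType")]
HB.structure Definition Polish d (R : realType) :=
  { E of Metric R E & Complete E & Measurable d E & isPolish d R E }.

Section Measures.
Context d (T : measurableType d) (R : realType).

(* A [probability] is a function on all subsets of [T], whose values on
   non-measurable sets carry no information. *)
Definition eq_measure (mu nu : probability T R) : Prop :=
  forall A, measurable A -> mu A = nu A.

Definition relative_entropy (nu mu : probability T R) : \bar R :=
  if pselect (nu `<< mu) then
    \int[nu]_x lne (Radon_Nikodym (charge_of_finite_measure nu) mu x)
  else +oo.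

End Measures.

Section Tuples.
Context d (T : measurableType d) (R : realType).

Definition coord n (i : 'I_n) (x : n.-tuple T) : T := tnth x i.

Lemma measurable_coord n (i : 'I_n) : measurable_fun setT (@coord n i).
Proof. exact: measurable_tnth. Qed.

HB.instance Definition _ n (i : 'I_n) :=
  isMeasurableFun.Build _ _ (n.-tuple T) T (@coord n i) (@measurable_coord n i).

Definition reindex_tuple n k (f : 'I_k -> 'I_n) (x : n.-tuple T) : k.-tuple T :=
  [tuple tnth x (f i) | i < k].

Lemma measurable_reindex_tuple n k (f : 'I_k -> 'I_n) :
  measurable_fun setT (reindex_tuple f).
Proof.
apply/measurable_fun_tnthP => i.
rewrite (_ : _ \o _ = @coord n (f i)); first exact: measurable_coord.
by apply/funext => x; rewrite /= tnth_mktuple.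
Qed.

HB.instance Definition _ n k (f : 'I_k -> 'I_n) :=
  isMeasurableFun.Build _ _ (n.-tuple T) (k.-tuple T) (reindex_tuple f)
    (@measurable_reindex_tuple n k f).

Definition first_coords n k (le_kn : (k <= n)%N) : {mfun n.-tuple T >-> k.-tuple T} :=
  reindex_tuple (widen_ord le_kn).

Definition exchangeable n (mu : probability (n.-tuple T) R) : Prop :=
  forall s : 'S_n, eq_measure (distribution mu (reindex_tuple s)) mu.

Definition tuple_cons n (x : T * n.-tuple T) : n.+1.-tuple T := [tuple of x.1 :: x.2].

Lemma measurable_tuple_cons n : measurable_fun setT (@tuple_cons n).
Proof. exact: (@measurable_cons _ _ _ _ fst n snd). Qed.

HB.instance Definition _ n :=
  isMeasurableFun.Build _ _ (T * n.-tuple T)%type (n.+1.-tuple T) (@tuple_cons n)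
    (@measurable_tuple_cons n).

Fixpoint product_power (mu : probability T R) n : probability (n.-tuple T) R :=
  if n is m.+1
  then distribution (mu \x product_power mu m : probability _ R) (@tuple_cons m)
  else \d_[tuple].

End Tuples.
Arguments first_coords {d T n k} le_kn.

Section Wasserstein.
Context d (R : realType) (E : polishType d R).

Definition second_moment (o : E) (mu : probability E R) : \bar R :=
  \int[mu]_x ((mdist o x) ^+ 2)%:E.

Definition P2 (o : E) (mu : probability E R) : Prop := second_moment o mu < +oo.

(* As [E] is separable, the product sigma-algebra carried by [k.-tuple E] is
   the Borel sigma-algebra of the product topology. *)
Definition P2_tuple (o : E) k (mu : probability (k.-tuple E) R) : Prop :=
  \int[mu]_x (\sum_(i < k) (mdist o (tnth x i)) ^+ 2)%R%:E < +oo.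

Definition coupling k (mu nu : probability (k.-tuple E) R) :
    set (probability (k.-tuple E * k.-tuple E)%type R) :=
  [set pi | forall A, measurable A ->
     pi (A `*` setT) = mu A /\ pi (setT `*` A) = nu A].

Definition W2 k (mu nu : probability (k.-tuple E) R) : \bar R :=
  ereal_inf [set poweR (\int[pi]_z
      (\sum_(i < k) (mdist (tnth z.1 i) (tnth z.2 i)) ^+ 2)%R%:E) 2^-1
    | pi in coupling mu nu].

End Wasserstein.

Section MarkovProcesses.
Context (R : realType).

(* Time is [0, +oo[: values of [p] and [X] at negative times are irrelevant. *)
Definition transition_semigroup d (S : measurableType d)
    (p : R -> R.-pker S ~> S) : Prop :=
  (forall x A, measurable A -> p 0%R x A = \d_x A) /\
  (forall s t x A, (0 <= s)%R -> (0 <= t)%R -> measurable A ->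
     p (s + t)%R x A = \int[p s x]_y p t y A).

Definition history d (Omega : measurableType d) (P : probability Omega R)
    d' (S : measurableType d') (X : R -> {RV P >-> S}) (s : R) :
    set (set Omega) :=
  <<s [set F | exists u A, [/\ (0 <= u <= s)%R, measurable A & F = X u @^-1` A]] >>.

Definition markov_process d (Omega : measurableType d) (P : probability Omega R)
    d' (S : measurableType d') (p : R -> R.-pker S ~> S)
    (X : R -> {RV P >-> S}) : Prop :=
  forall s t F A, (0 <= s)%R -> (0 <= t)%R -> history X s F -> measurable A ->
    P (F `&` X (s + t)%R @^-1` A) = \int[P]_(w in F) p t (X s w) A.

Definition continuous_paths d (Omega : measurableType d)
    (P : probability Omega R) d' (E : polishType d' R) N
    (X : R -> {RV P >-> N.-tuple E}) : Prop :=
  forall w (i : 'I_N),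
    {within `[0%R, +oo[, continuous (fun t : R => tnth (X t w) i)}.

(* A time-homogeneous Markov process is its transition kernels [p] together with
   a freely chosen initial law; [X] is a realisation of it. [N.-tuple E] carries
   no topology in the library, hence the coordinatewise [continuous_paths]. *)
Definition particle_system d (Omega : measurableType d)
    (P : probability Omega R) d' (E : polishType d' R) (o : E) N
    (p : R -> R.-pker (N.-tuple E) ~> (N.-tuple E))
    (X : R -> {RV P >-> N.-tuple E}) : Prop :=
  [/\ markov_process p X,
      continuous_paths X,
      (forall t (i : 'I_N), (0 <= t)%R ->
         P2 o (distribution (distribution P (X t)) (coord i))) &
      (forall t, (0 <= t)%R -> exchangeable (distribution P (X t)))].

End MarkovProcesses.

Section NonlinearSemigroup.
Context d (R : realType) (E : polishType d R) (o : E).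

(* A family of mappings on P_2(E), given on representatives up to
   [eq_measure]. *)
Definition P2_semigroup (Pstar : R -> probability E R -> probability E R) : Prop :=
  [/\ (forall t mu, (0 <= t)%R -> P2 o mu -> P2 o (Pstar t mu)),
      (forall mu, P2 o mu -> eq_measure (Pstar 0%R mu) mu) &
      (forall s t mu, (0 <= s)%R -> (0 <= t)%R -> P2 o mu ->
         eq_measure (Pstar s (Pstar t mu)) (Pstar (s + t)%R mu))].

Definition invariant_measure (Pstar : R -> probability E R -> probability E R)
    (mu : probability E R) : Prop :=
  P2 o mu /\ forall t, (0 <= t)%R -> eq_measure (Pstar t mu) mu.

Definition unique_invariant_measure
    (Pstar : R -> probability E R -> probability E R)
    (mu : probability E R) : Prop :=
  invariant_measure Pstar mu /\
  forall nu, invariant_measure Pstar nu -> eq_measure nu mu.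

End NonlinearSemigroup.

(* Main.v *)
(** By Donsker-Varadhan duality, Ent(nu|mu) is the supremum over bounded
    measurable [f] of nu(f) + 1 - mu(e^f). Testing with a sum of one function
    over [N %/ k] disjoint blocks of [k] coordinates shows that, for exchangeable
    nu on E^N, [N %/ k] times the entropy of the k-marginal against mu^k is at
    most Ent(nu|mu^N): this produces the factor k/N. For t > t0 the entropy
    estimate is applied on [t - t0, t], the distance at time t - t0 being
    controlled by the Wasserstein estimate. In the limit t -> oo, W2-convergence
    passes through test functions with |f x - f y| <= e + C d(x,y)^2, and these
    are dense in L^1, so the duality formula gives lower semicontinuity. *)
Require Import Defs.
From HB Require Import structures.
From mathcomp Require Import all_boot all_order all_algebra all_fingroup.
From mathcomp Require Import all_classical all_reals all_analysis.
From mathcomp Require Import measurable_realfun.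
From mathcomp Require Import ring lra.

Set Implicit Arguments.
Unset Strict Implicit.
Unset Printing Implicit Defensive.

Import Order.TTheory GRing.Theory Num.Theory.
Import numFieldNormedType.Exports.

Local Open Scope classical_set_scope.
Local Open Scope ring_scope.
Local Open Scope ereal_scope.

(* MathComp-Analysis has a lemma of the same name. *)
Local Notation eq_measure := Defs.eq_measure.

(** The form nu(f) + 1 - mu(e^f) is preferred to nu(f) - log mu(e^f) because it is affine in the two
    integrals: it survives L^1 approximation directly, without the logarithm of a limit. Each fact
    about entropy (marginals, limits, replacing a measure by an equal one) then reduces to a choice
    of test function, so that neither a chain rule nor a disintegration of measures enters. The
    obstacle in the limit is that tuples carry a sigma-algebra but no topology, so there is no weak
    convergence on E^N to appeal to. Continuity is therefore measured by the transport cost itself,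
    and density is proved set by set, from balls of E up through the operations of a sigma-algebra.
    The limit also requires a finite initial distance, since the vanishing factor g multiplies it;
    the second moments of the one-particle laws and of the reference measure provide this. *)

Section BoundedIntegrals.
Context d (T : measurableType d) (R : realType).
Implicit Types (mu : probability T R) (f : T -> R).

(** The bound is pointwise, with no reference to a measure, so that one function and its exponential
    are integrable against every probability measure at once. *)
Definition bounded_measurable f : Prop :=
  measurable_fun setT f /\ exists M, forall x, (`|f x| <= M)%R.

Lemma bounded_measurable_integrable mu f :
  bounded_measurable f -> mu.-integrable setT (EFin \o f).
Proof.
move=> [mf [M fM]]; apply: measurable_bounded_integrable => //.
  by apply: le_lt_trans (probability_le1 _ measurableT) (ltry _).
exists M; split; first exact: num_real.
by move=> y My x _; apply: (le_trans (fM x)); exact: ltW.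
Qed.

Lemma bounded_measurable_expR f :
  bounded_measurable f -> bounded_measurable (fun x => expR (f x)).
Proof.
move=> [mf [M fM]]; split; first by apply: measurableT_comp => //; exact: measurable_expR.
exists (expR M) => x; rewrite ger0_norm ?expR_ge0// ler_expR.
exact: le_trans (ler_norm _) (fM x).
Qed.

Lemma bounded_measurable_cst c : bounded_measurable (fun=> c : R).
Proof. by split; [exact: measurable_cst|exists `|c|%R]. Qed.

Lemma bounded_measurableD f g : bounded_measurable f -> bounded_measurable g ->
  bounded_measurable (fun x => (f x + g x)%R).
Proof.
move=> [mf [M fM]] [mg [M' gM]]; split; first exact: measurable_funD.
by exists (M + M')%R => x; apply: (le_trans (ler_normD _ _)); exact: lerD.
Qed.

Lemma bounded_measurableM f g : bounded_measurable f -> bounded_measurable g ->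
  bounded_measurable (fun x => (f x * g x)%R).
Proof.
move=> [mf [M fM]] [mg [M' gM]]; split; first exact: measurable_funM.
by exists (M * M')%R => x; rewrite normrM; exact: ler_pM.
Qed.

Lemma bounded_measurable_sum n (f : 'I_n -> T -> R) :
  (forall i, bounded_measurable (f i)) ->
  bounded_measurable (fun x => (\sum_i f i x)%R).
Proof.
elim: n f => [|n IH] f bf.
  under [X in bounded_measurable X]eq_fun do rewrite big_ord0.
  exact: bounded_measurable_cst.
under [X in bounded_measurable X]eq_fun do rewrite big_ord_recl.
by apply: bounded_measurableD => //; exact: IH.
Qed.

Lemma integrable_EFinD mu f g : mu.-integrable setT (EFin \o f) ->
  mu.-integrable setT (EFin \o g) ->
  mu.-integrable setT (EFin \o (fun x => f x + g x)%R).
Proof. by move=> fi gi; exact: (integrableD measurableT fi gi). Qed.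

Lemma integrable_EFinB mu f g : mu.-integrable setT (EFin \o f) ->
  mu.-integrable setT (EFin \o g) ->
  mu.-integrable setT (EFin \o (fun x => f x - g x)%R).
Proof. by move=> fi gi; exact: (integrableB measurableT fi gi). Qed.

Lemma integral_prob_cst mu (c : \bar R) : \int[mu]_x c = c.
Proof. by rewrite integral_cst// [X in _ * X]probability_setT mule1. Qed.

Lemma Rintegral_prob_cst mu (c : R) : (\int[mu]_x c)%R = c.
Proof.
by rewrite Rintegral_cst// [X in fine X]probability_setT mulr1.
Qed.

Lemma Rintegral_EFin mu f : mu.-integrable setT (EFin \o f) ->
  \int[mu]_x (f x)%:E = (\int[mu]_x f x)%:E.
Proof. by move=> fi; rewrite fineK//; exact: integrable_fin_num. Qed.

End BoundedIntegrals.

Lemma bounded_measurable_comp d (T : measurableType d) d' (T' : measurableType d')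
    (R : realType) (phi : T' -> T) (f : T -> R) :
  measurable_fun setT phi -> bounded_measurable f ->
  bounded_measurable (f \o phi).
Proof.
move=> mphi [mf [M fM]]; split; last by exists M => x; exact: fM.
exact: measurableT_comp.
Qed.

(** * Variational formula for the relative entropy *)

Section RelativeEntropyDuality.
Context d (T : measurableType d) (R : realType).
Implicit Types (mu nu : probability T R).

(** Trades the extended-real derivative for a version that is finite and nonnegative everywhere.
    Passing from [lne] to [ln] can change the integrand only where the density vanishes, and nu does
    not charge that set: its indicator times [r] is zero. *)
Lemma relative_entropy_density nu mu : nu `<< mu ->
  exists r : T -> R, [/\ measurable_fun setT r, forall x, (0 <= r x)%R,
    (forall f : T -> \bar R, (forall x, 0 <= f x) -> measurable_fun setT f ->
       \int[mu]_x (f x * (r x)%:E) = \int[nu]_x f x),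
    nu [set x | r x = 0%R] = 0 &
    relative_entropy nu mu = \int[nu]_x (ln (r x))%:E].
Proof.
move=> numu; pose F := Radon_Nikodym_SigmaFinite.f nu mu.
have Ffin := Radon_Nikodym_SigmaFinite.f_fin_num numu.
have F0 := Radon_Nikodym_SigmaFinite.f_ge0 numu.
have mF : measurable_fun setT F.
  by apply: measurable_int; exact: Radon_Nikodym_SigmaFinite.f_integrable numu.
pose r x := fine (F x).
have rE x : (r x)%:E = F x by rewrite fineK// Ffin.
have mr : measurable_fun setT r by exact: measurableT_comp.
have r0 x : (0 <= r x)%R by rewrite fine_ge0// F0.
have chg (f : T -> \bar R) : (forall x, 0 <= f x) -> measurable_fun setT f ->
    \int[mu]_x (f x * (r x)%:E) = \int[nu]_x f x.
  move=> f0 mf; under eq_integral do rewrite rE.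
  exact: Radon_Nikodym_SigmaFinite.change_of_variables.
have mZ : measurable [set x | r x = 0%R].
  rewrite (_ : [set _ | _] = r @^-1` [set 0%R]) // -[X in measurable X]setTI.
  exact: mr.
have nuZ : nu [set x | r x = 0%R] = 0.
  have := chg (fun x => (\1_[set x | r x = 0%R] x)%:E).
  rewrite integral_indic// setIT => <- //.
  - rewrite integral0_eq// => x _; rewrite indicE.
    case: (boolP (x \in _)) => [|_]; last by rewrite mul0e.
    by rewrite inE/= => ->; rewrite mule0.
  - by apply/measurable_EFinP; exact: measurable_indic.
exists r; split => //.
rewrite /relative_entropy; destruct (pselect (nu `<< mu)) as [numu'|] => //.
have mRN : measurable_fun setT (Radon_Nikodym (charge_of_finite_measure nu) mu).
  by apply: measurable_int; exact: Radon_Nikodym_integrable.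
have RNfin x := Radon_Nikodym_fin_num (nu := charge_of_finite_measure nu) x numu.
have mlneRN : measurable_fun setT
    (fun x => lne (Radon_Nikodym (charge_of_finite_measure nu) mu x)).
  rewrite (_ : (fun x => _) = fun x =>
    if Radon_Nikodym (charge_of_finite_measure nu) mu x <= 0 then -oo else
    (ln (fine (Radon_Nikodym (charge_of_finite_measure nu) mu x)))%:E).
    apply: measurable_fun_ifT => //.
      exact: measurable_fun_lee.
    apply/measurable_EFinP; apply: measurableT_comp => //.
    exact: measurableT_comp.
  apply/funext => x; case: ifPn => [|x0]; first exact: le0_lneNy.
  rewrite -[in LHS](fineK (RNfin x)) lne_EFin// fine_gt0// ltNge x0 /=.
  by rewrite ltey_eq RNfin.
apply: ae_eq_integral => //.
- by apply/measurable_EFinP; apply: measurableT_comp.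
(* The two derivatives agree mu-almost everywhere; domination turns this into nu-almost everywhere,
   as the integral against nu requires. *)
have /(null_dominates_ae_eq measurableT numu) :=
  @ae_eq_Radon_Nikodym_SigmaFinite _ _ _ nu mu numu setT measurableT.
move=> aeRN; have aeZ : {ae nu, forall x, r x != 0%R}.
  exists [set x | r x = 0%R]; split => // x /=.
  by move=> /negP; rewrite negbK => /eqP.
apply: filterS2 aeRN aeZ => x /= RNx rx0 _.
by rewrite -RNx// -/F -rE lne_EFin// lt_def rx0 r0.
Qed.

(** The negative part of ln r is at most e^(- ln r), that is 1/r where r > 0, and the nu-integral of
    1/r is mu(r > 0) <= 1. Hence the entropy integral is never of the form oo - oo. *)
Lemma density_neg_part_integrable (nu mu : probability T R) (r : T -> R) :
  measurable_fun setT r -> (forall x, 0 <= r x)%R ->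
  (forall f : T -> \bar R, (forall x, 0 <= f x) -> measurable_fun setT f ->
       \int[mu]_x (f x * (r x)%:E) = \int[nu]_x f x) ->
  nu.-integrable setT (EFin \o (fun x => Num.max (- ln (r x)) 0)%R).
Proof.
move=> mr r0 chg.
have mln : measurable_fun setT (fun x => ln (r x)) by exact: measurableT_comp.
apply/integrableP; split.
  by apply/measurable_EFinP; apply: measurable_maxr => //; exact: measurableT_comp.
have mex : measurable_fun setT (fun x => (expR (- ln (r x)))%:E).
  apply/measurable_EFinP; apply: measurableT_comp; first exact: measurable_expR.
  exact: measurableT_comp.
apply: (@le_lt_trans _ _ (\int[nu]_x (expR (- ln (r x)))%:E)).
  apply: ge0_le_integral => //.
    apply/measurable_EFinP; apply: measurableT_comp => //.
    by apply: measurable_maxr => //; exact: measurableT_comp.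
  move=> x _ /=; rewrite lee_fin ger0_norm ?le_max ?lexx ?orbT//.
  rewrite ge_max expR_ge0 andbT (le_trans _ (expR_ge1Dx _))// lerDr//.
rewrite -chg//.
apply: (@le_lt_trans _ _ (\int[mu]_x (cst 1) x)).
  apply: ge0_le_integral => //.
  - by move=> x _; rewrite -EFinM lee_fin mulr_ge0 ?expR_ge0.
  - by apply: emeasurable_funM => //; exact/measurable_EFinP.
  - move=> x _; rewrite -EFinM lee_fin.
    have [->|rx] := eqVneq (r x) 0%R; first by rewrite mulr0.
    by rewrite expRN lnK ?mulVf// posrE lt_def rx r0.
by rewrite integral_prob_cst ltry.
Qed.

(** Integrate 1 + x <= e^x at x = f - ln r against nu; on the right the density cancels against e^(-
    ln r). *)
Lemma relative_entropy_le_dual nu mu (L : R) (f : T -> R) :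
  relative_entropy nu mu <= L%:E -> bounded_measurable f ->
  ((\int[nu]_x f x) + 1 <= L + \int[mu]_x expR (f x))%R.
Proof.
have [numu|numu] := pselect (nu `<< mu); last first.
  by rewrite /relative_entropy; case: pselect.
have [r [mr r0 chg nuZ ->]] := relative_entropy_density numu.
move=> entL bf.
have negi := density_neg_part_integrable mr r0 chg.
have mln : measurable_fun setT (fun x => ln (r x)) by exact: measurableT_comp.
(* [entL] bounds only the difference of the positive and the negative part; since the negative part
   has a finite integral, so has the positive one. *)
have lni : nu.-integrable setT (EFin \o (fun x => ln (r x))).
  apply/integrableP; split; first exact/measurable_EFinP.
  pose p := fun x => Num.max (ln (r x)) 0%R.
  have mp : measurable_fun setT p by exact: measurable_maxr.
  rewrite (_ : (fun x => _) = (fun x => (p x)%:E + (Num.max (- ln (r x)) 0%R)%:E)).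
    rewrite ge0_integralD//.
    + apply: lte_add_pinfty; last exact: integrable_lty negi.
      have -> : \int[nu]_x (p x)%:E = \int[nu]_x ((EFin \o (fun x => ln (r x)))^\+ x).
        by apply: eq_integral => x _; rewrite funeposE /= EFin_max.
      move: entL; rewrite integralE.
      have -> : \int[nu]_x ((fun x => (ln (r x))%:E)^\- x) =
                \int[nu]_x (Num.max (- ln (r x)) 0%R)%:E.
        by apply: eq_integral => x _; rewrite funenegE /= EFin_max.
      rewrite leeBlDr; last exact: integrable_fin_num negi.
      move=> /le_lt_trans; apply; rewrite lte_add_pinfty ?ltry//.
      exact: integrable_lty negi.
    + by move=> x _; rewrite lee_fin le_max lexx orbT.
    + exact/measurable_EFinP.
    + by move=> x _; rewrite lee_fin le_max lexx orbT.
    + exact: measurable_int negi.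
  apply/funext => x; rewrite /p /= -EFinD; congr EFin.
  case: (leP 0%R (ln (r x))) => h.
    by rewrite ger0_norm//; case: leP; lra.
  by rewrite ltr0_norm//; case: leP; lra.
move: entL; rewrite Rintegral_EFin// lee_fin => entL.
have mf : measurable_fun setT f by case: bf.
have bfi := bounded_measurable_integrable mu (bounded_measurable_expR bf).
pose u x := expR (f x - ln (r x)).
have mu_ : measurable_fun setT u.
  apply: measurableT_comp; first exact: measurable_expR.
  exact: measurable_funB.
(* Only an inequality: e^(f - ln r) r equals e^f where r > 0 but is 0 where r = 0, a set that mu may
   charge. *)
have ule : \int[nu]_x (u x)%:E <= \int[mu]_x (expR (f x))%:E.
  rewrite -chg; last first.
  - exact/measurable_EFinP.
  - by move=> x; rewrite lee_fin expR_ge0.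
  apply: ge0_le_integral => //.
  - by move=> x _; rewrite -EFinM lee_fin mulr_ge0 ?expR_ge0.
  - by apply: emeasurable_funM => //; exact/measurable_EFinP.
  - exact: measurable_int bfi.
  - move=> x _; rewrite -EFinM lee_fin /u expRD -mulrA ler_piMr ?expR_ge0//.
    have [->|rx] := eqVneq (r x) 0%R; first by rewrite mulr0.
    by rewrite expRN lnK ?mulVf// posrE lt_def rx r0.
have ui : nu.-integrable setT (EFin \o u).
  apply/integrableP; split; first exact/measurable_EFinP.
  under eq_integral do rewrite /= ger0_norm ?expR_ge0//.
  by apply: (le_lt_trans ule); exact: integrable_lty bfi.
move: ule; rewrite !Rintegral_EFin// lee_fin => ule.
have fi := bounded_measurable_integrable nu bf.
have ci := bounded_measurable_integrable nu (bounded_measurable_cst T 1%R).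
have : (\int[nu]_x (f x + 1) <= \int[nu]_x (ln (r x) + u x))%R.
  apply: le_Rintegral => //.
  - exact: integrable_EFinD.
  - exact: integrable_EFinD.
  - move=> x _; have := expR_ge1Dx (f x - ln (r x))%R; rewrite -/(u x); lra.
rewrite !RintegralD// Rintegral_prob_cst.
lra.
Qed.

(** Used with [l] = ln r. The right-hand side is [l] clipped to [-a, a], bounded and hence
    admissible as a test function; the left-hand side isolates a truncated positive part, ready for
    monotone convergence, from the full negative part, already known to be integrable. *)
Lemma truncation_le (a l : R) : (0 <= a)%R ->
  (Num.min a (Num.max l 0) - Num.max (- l) 0 <= Num.max (- a) (Num.min a l))%R.
Proof.
move=> a0; have [l0|l0] := leP 0%R l.
  rewrite [Num.max (- l)%R _]max_r ?oppr_le0// subr0.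
  by rewrite le_max lexx orbT.
rewrite [Num.max (- l)%R _]max_l ?oppr_ge0 ?(ltW l0)//.
rewrite (min_r a0) (min_r (le_trans (ltW l0) a0)) sub0r opprK.
by rewrite le_max lexx orbT.
Qed.

Lemma relative_entropy_le nu mu (L : R) :
  (forall f : T -> R, bounded_measurable f ->
     ((\int[nu]_x f x) + 1 <= L + \int[mu]_x expR (f x))%R) ->
  relative_entropy nu mu <= L%:E.
Proof.
move=> dual.
(* On a mu-null set A, test with n 1_A: the exponential integral stays equal to 1, so n nu(A) <= L
   for every n, which forces nu(A) = 0. *)
have numu : nu `<< mu.
  apply/null_content_dominatesP => A mA muA.
  have nuAE : nu A = (\int[nu]_x \1_A x)%R%:E.
    rewrite -Rintegral_EFin; first by rewrite integral_indic// setIT.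
    apply: bounded_measurable_integrable; split; first exact: measurable_indic.
    by exists 1%R => x; rewrite indicE; case: (_ \in _); rewrite ?normr1 ?normr0.
  rewrite nuAE; congr EFin; set a := Rintegral _ _ _.
  have a0 : (0 <= a)%R by rewrite -lee_fin -nuAE measure_ge0.
  have bA n : bounded_measurable (fun x => (n%:R * \1_A x : R)%R).
    apply: bounded_measurableM; first exact: bounded_measurable_cst.
    split; first exact: measurable_indic.
    by exists 1%R => x; rewrite indicE; case: (_ \in _); rewrite ?normr1 ?normr0.
  have na n : (n%:R * a <= L)%R.
    have := dual _ (bA n).
    rewrite RintegralZl//; last first.
      apply: bounded_measurable_integrable; split; first exact: measurable_indic.
      by exists 1%R => x; rewrite indicE; case: (_ \in _); rewrite ?normr1 ?normr0.
    rewrite -/a; suff -> : (\int[mu]_x expR (n%:R * \1_A x) = 1)%R by lra.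
    rewrite -[RHS](Rintegral_prob_cst mu) /Rintegral; congr fine.
    apply: ae_eq_integral => //.
      by apply/measurable_EFinP; case: (bounded_measurable_expR (bA n)).
    exists A; split => // x /= xA; apply: contrapT => nA; apply: xA => _.
    by rewrite indicE memNset// mulr0 expR0.
  apply/eqP; rewrite eq_le a0 andbT leNgt; apply/negP => a_gt0.
  have := na (Num.truncn (L / a)).+1.
  rewrite leNgt => /negP; apply; rewrite -ltr_pdivrMr//.
  exact: truncnS_gt.
have [r [mr r0 chg nuZ ->]] := relative_entropy_density numu.
have negi := density_neg_part_integrable mr r0 chg.
have mln : measurable_fun setT (fun x => ln (r x)) by exact: measurableT_comp.
pose q x := Num.max (- ln (r x))%R 0%R; pose p x := Num.max (ln (r x)) 0%R.
have mq : measurable_fun setT q.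
  by apply: measurable_maxr => //; exact: measurableT_comp.
have mp : measurable_fun setT p by exact: measurable_maxr.
rewrite integralE.
have -> : \int[nu]_x ((fun x => (ln (r x))%:E)^\- x) = \int[nu]_x (q x)%:E.
  by apply: eq_integral => x _; rewrite funenegE /= EFin_max.
have -> : \int[nu]_x ((fun x => (ln (r x))%:E)^\+ x) = \int[nu]_x (p x)%:E.
  by apply: eq_integral => x _; rewrite funeposE /= EFin_max.
rewrite (Rintegral_EFin negi) leeBlDr// -EFinD.
set Q := (\int[nu]_x q x)%R.
pose pn n x := Num.min n%:R (p x).
have bpn n : bounded_measurable (pn n).
  split; first exact: measurable_minr.
  exists n%:R => x; rewrite ger0_norm; first by rewrite ge_min lexx.
  by rewrite /pn /p le_min ler0n le_max lexx orbT.
have key n : (\int[nu]_x pn n x <= L + Q + expR (- n%:R))%R.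
  pose F x := Num.max (- n%:R)%R (Num.min n%:R (ln (r x))).
  (* The ideal test function is ln r. Where r = 0 the value of [ln] is a mere default, while mu may
     charge this set, so -n is imposed there; nu does not see the change. Then e^G <= r + e^(-n)
     everywhere, whence mu(e^G) <= 1 + e^(-n). *)
  pose G x := if r x == 0%R then (- n%:R)%R else F x.
  have Fb x : (`|F x| <= n%:R)%R.
    rewrite ler_norml /F le_max lexx /= ge_max ge_min lexx /= andbT.
    by have := ler0n R n; lra.
  have mF : measurable_fun setT F.
    by apply: measurable_maxr => //; exact: measurable_minr.
  have bF : bounded_measurable F by split => //; exists n%:R.
  have mG : measurable_fun setT G.
    apply: measurable_fun_ifT => //.
    by apply: measurable_fun_eqr.
  have bG : bounded_measurable G.
    split => //; exists n%:R => x; rewrite /G; case: ifP => // _.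
    by rewrite normrN ger0_norm// ler0n.
  have FG : (\int[nu]_x F x = \int[nu]_x G x)%R.
    rewrite /Rintegral; congr fine; apply: ae_eq_integral => //.
      exact/measurable_EFinP.
      exact/measurable_EFinP.
    exists [set x | r x = 0%R]; split => //.
      rewrite (_ : [set _ | _] = r @^-1` [set 0%R]) // -[X in measurable X]setTI.
      exact: mr.
    move=> x /= nFG; apply: contrapT => /eqP rx; apply: nFG => _.
    by rewrite /G (negbTE rx).
  have := dual G bG; rewrite -FG => dG.
  have : (\int[nu]_x (pn n x - q x) <= \int[nu]_x F x)%R.
    apply: le_Rintegral => //.
    - apply: integrable_EFinB => //; exact: bounded_measurable_integrable.
    - exact: bounded_measurable_integrable.
    - by move=> x _; apply: truncation_le; exact: ler0n.
  rewrite RintegralB//; last exact: bounded_measurable_integrable.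
  rewrite -/Q => le1.
  have [ri r1] : mu.-integrable setT (EFin \o r) /\ (\int[mu]_x r x = 1)%R.
    have rE : \int[mu]_x (r x)%:E = 1.
      transitivity (\int[mu]_x (1 * (r x)%:E)).
        by apply: eq_integral => x _; rewrite mul1e.
      by rewrite (chg (cst 1))// integral_prob_cst.
    have ri : mu.-integrable setT (EFin \o r).
      apply/integrableP; split; first exact/measurable_EFinP.
      under eq_integral do rewrite /= ger0_norm//.
      by rewrite rE ltry.
    by split => //; rewrite /Rintegral rE.
  have : (\int[mu]_x expR (G x) <= \int[mu]_x (r x + expR (- n%:R)))%R.
    have ci := bounded_measurable_integrable mu (bounded_measurable_cst T (expR (- n%:R))%R).
    apply: le_Rintegral => //.
    - apply: bounded_measurable_integrable; exact: bounded_measurable_expR.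
    - exact: integrable_EFinD.
    - move=> x _; rewrite /G; case: eqVneq => [->|rx]; first by rewrite add0r.
      have rp : (0 < r x)%R by rewrite lt_def rx r0.
      rewrite /F; set l := Num.min _ _; have [h|h] := leP (- n%:R)%R l.
        apply: (@le_trans _ _ (expR (ln (r x)))).
          by rewrite ler_expR /l ge_min lexx orbT.
        by rewrite lnK ?posrE// lerDl expR_ge0.
      by rewrite lerDr.
  rewrite RintegralD//; last first.
    exact: (bounded_measurable_integrable mu (bounded_measurable_cst T _)).
  rewrite Rintegral_prob_cst r1; lra.
have mono : \int[nu]_x (pn n x)%:E @[n --> \oo] --> \int[nu]_x (p x)%:E.
  rewrite (_ : \int[nu]_x (p x)%:E = \int[nu]_x limn (fun n => (pn n x)%:E)).
    apply: cvg_monotone_convergence => //.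
    - by move=> n; apply/measurable_EFinP; case: (bpn n).
    - by move=> n x _; rewrite lee_fin /pn /p le_min ler0n le_max lexx orbT.
    - move=> x _ a b ab; rewrite lee_fin /pn.
      by rewrite le_min !ge_min ler_nat ab lexx orbT.
  apply: eq_integral => x _; apply/esym/cvg_lim => //.
  apply: cvg_near_cst; near=> n; rewrite /pn; congr EFin; apply/min_idPr.
  near: n; exact: nbhs_infty_ger.
have cvgL : (L + Q + expR (- n%:R))%:E @[n --> \oo] --> (Q + L)%:E.
  apply: cvg_EFin; first by near=> n.
  rewrite (_ : (Q + L = L + Q + 0)%R); last by lra.
  apply: cvgD; first exact: cvg_cst.
  have := @cvgn_expR R; apply: cvg_trans; apply: near_eq_cvg.
  by near=> n.
rewrite addrC.
rewrite -(cvg_lim (@ereal_hausdorff R) mono) -(cvg_lim (@ereal_hausdorff R) cvgL).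
apply: lee_lim; [exact: cvgP mono|exact: cvgP cvgL|].
near=> n; rewrite Rintegral_EFin ?lee_fin ?key//; exact: bounded_measurable_integrable.
Unshelve. all: by end_near. Qed.

(** The zero test function shows that every real upper bound of the entropy is nonnegative; the
    value -oo is excluded because it would admit the bound -1. *)
Lemma relative_entropy_ge0 nu mu : 0 <= relative_entropy nu mu.
Proof.
have key L : relative_entropy nu mu <= L%:E -> (0 <= L)%R.
  move=> /relative_entropy_le_dual/(_ (bounded_measurable_cst T 0%R)).
  by rewrite Rintegral_prob_cst expR0 Rintegral_prob_cst; lra.
case E : (relative_entropy nu mu) => [r| |] //.
  by rewrite lee_fin; apply: key; rewrite E.
have : (0 <= -1 :> R)%R by apply: key; rewrite E leNye.
by rewrite ler0N1.
Qed.

End RelativeEntropyDuality.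

(** * Measures that agree on measurable sets *)

Section EqMeasure.
Context d (T : measurableType d) (R : realType).
Implicit Types (mu nu : probability T R).

Lemma eq_measure_sym mu nu : eq_measure mu nu -> eq_measure nu mu.
Proof. by move=> e A mA; rewrite e. Qed.

Lemma eq_measure_Rintegral mu nu (f : T -> R) : eq_measure mu nu ->
  (\int[mu]_x f x = \int[nu]_x f x)%R.
Proof.
by move=> e; congr fine; apply: eq_measure_integral => A mA _; exact: e.
Qed.

(** Duality spares a comparison of Radon-Nikodym derivatives: it sees the measures only through
    integrals. The semigroup law and invariance hold up to [eq_measure], so this is how they reach
    the entropy. *)
Lemma relative_entropy_le_eq_measure (nu nu' mu mu' : probability T R) :
  eq_measure nu nu' -> eq_measure mu mu' ->
  relative_entropy nu mu <= relative_entropy nu' mu'.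
Proof.
move=> enu emu; have := relative_entropy_ge0 nu' mu'.
case E : (relative_entropy nu' mu') => [L| |] // _; last exact: leey.
apply: relative_entropy_le => f bf.
rewrite (eq_measure_Rintegral _ enu) (eq_measure_Rintegral _ emu).
by apply: relative_entropy_le_dual => //; rewrite E.
Qed.

Lemma Rintegral_distribution d' (T' : measurableType d')
    mu (X : {RV mu >-> T'}) (f : T' -> R) : bounded_measurable f ->
  (\int[distribution mu X]_y f y = \int[mu]_x f (X x))%R.
Proof.
move=> bf; congr fine; rewrite integral_distribution//.
  by apply/measurable_EFinP; case: bf.
apply: (bounded_measurable_integrable mu (f := f \o X)).
exact: bounded_measurable_comp.
Qed.

End EqMeasure.

(** * Product powers, blocks of coordinates and exchangeability *)

Section ProductPower.
Context d (T : measurableType d) (R : realType).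
Implicit Types (mu : probability T R).

Lemma ge0_integral_product_powerS mu n (f : n.+1.-tuple T -> \bar R) :
  measurable_fun setT f -> (forall x, 0 <= f x) ->
  \int[product_power mu n.+1]_x f x =
  \int[mu]_x \int[product_power mu n]_y f (tuple_cons (x, y)).
Proof.
move=> mf f0 /=; rewrite ge0_integral_distribution//.
by rewrite fubini_tonelli1//; [exact: measurableT_comp|move=> xy; exact: f0].
Qed.

Lemma eq_measure_product_power mu mu' n : eq_measure mu mu' ->
  eq_measure (product_power mu n) (product_power mu' n).
Proof.
move=> e; elim: n => [|n IH] A mA //=.
rewrite /distribution /pushforward /= /product_measure1.
have mB : measurable (@tuple_cons _ T n @^-1` A).
  by rewrite -[X in measurable X]setTI; exact: measurable_tuple_cons.
rewrite (eq_measure_integral mu') => [|B mB' _]; last exact: e.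
by apply: eq_integral => x _ /=; apply: IH; exact: measurable_xsection.
Qed.

(** Independence of the first [k] and the last [n] coordinates, by peeling off the head with Tonelli
    and induction on [k]. *)
Lemma ge0_integral_product_power_cat mu k n (G : k.-tuple T -> R)
    (H : n.-tuple T -> R) :
  measurable_fun setT G -> (forall x, 0 <= G x)%R ->
  measurable_fun setT H -> (forall x, 0 <= H x)%R ->
  \int[product_power mu (k + n)]_x
    (G (reindex_tuple (@lshift k n) x) * H (reindex_tuple (@rshift k n) x))%:E =
  (\int[product_power mu k]_x (G x)%:E) * \int[product_power mu n]_x (H x)%:E.
Proof.
elim: k G => [|k IH] G mG G0 mH H0.
  have -> : \int[product_power mu 0]_x (G x)%:E = (G [tuple])%:E.
    rewrite /= integral_dirac//; last exact/measurable_EFinP.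
    by rewrite diracT mul1e.
  rewrite -ge0_integralZl//; [|exact/measurable_EFinP|by move=> x _; rewrite lee_fin|by rewrite lee_fin].
  apply: eq_integral => x _; rewrite -EFinM tuple0; congr (_ * H _)%:E.
  by apply: eq_from_tnth => i; rewrite tnth_mktuple; congr tnth; exact/val_inj.
rewrite [LHS](ge0_integral_product_powerS mu (n := k + n)); last first.
- by move=> x; rewrite lee_fin mulr_ge0.
- apply/measurable_EFinP; apply: measurable_funM;
    by apply: measurableT_comp => //; exact: measurable_reindex_tuple.
rewrite [X in _ = X * _]ge0_integral_product_powerS; last first.
- by move=> x; rewrite lee_fin.
- exact/measurable_EFinP.
rewrite -ge0_integralZr//; last first.
- by apply: integral_ge0 => x _; rewrite lee_fin.
- by move=> x _; apply: integral_ge0 => y _; rewrite lee_fin.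
- apply: (@measurable_fun_fubini_tonelli_F _ _ _ _ _ (product_power mu k)
    (fun xy => (G (tuple_cons xy))%:E)) => [|xy]; last by rewrite lee_fin.
  by apply/measurable_EFinP; exact: measurableT_comp.
apply: eq_integral => x _; rewrite -IH//; last first.
  by apply: measurableT_comp => //; exact: measurableT_comp.
apply: eq_integral => y _; congr ((G _) * (H _))%:E; apply: eq_from_tnth => i.
- rewrite tnth_mktuple /tuple_cons; case: (unliftP ord0 i) => [j|] ->.
    rewrite (_ : lshift n (lift ord0 j) = lift ord0 (lshift n j)); last exact/val_inj.
    by rewrite !tnthS tnth_mktuple.
  by rewrite (_ : lshift n ord0 = ord0) ?tnth0//; exact/val_inj.
- rewrite !tnth_mktuple /tuple_cons.
  rewrite (_ : rshift k.+1 i = lift ord0 (rshift k i)); last exact/val_inj.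
  by rewrite tnthS.
Qed.

(** The blocks are consecutive: the first is [lshift], the others are the blocks of the remaining
    coordinates moved by [rshift]. Their disjointness is expressed by the factorised integral, the
    form in which it is used; coordinates left over at the end integrate to 1. *)
Lemma product_power_blocks mu k m N : (m * k <= N)%N ->
  exists b : 'I_m -> 'I_k -> 'I_N, (forall j, injective (b j)) /\
    forall G : k.-tuple T -> R, measurable_fun setT G -> (forall x, 0 <= G x)%R ->
    \int[product_power mu N]_x (\prod_j G (reindex_tuple (b j) x))%:E =
    (\int[product_power mu k]_x (G x)%:E) ^+ m.
Proof.
elim: m N => [|m IH] N.
  (* With [N] possibly 0 there may be no index to return, so the family of blocks is built by
     eliminating the empty type 'I_0. *)
  move=> _; exists (fun (i : 'I_0) _ => match i with Ordinal _ h => False_rect _ (Bool.diff_false_true h) end).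
  split=> [[]//|G mG G0].
  by under eq_integral do rewrite big_ord0; rewrite integral_prob_cst.
rewrite mulSn => kmN.
have kN : (k <= N)%N by exact: leq_trans (leq_addr _ _) kmN.
move: kmN; rewrite -(subnKC kN); move: (N - k)%N => n.
rewrite leq_add2l => /IH[b [binj bG]] {IH kN N}.
exists (fun j => if unlift ord0 j is Some j' then @rshift k n \o b j' else @lshift k n).
split=> [j|G mG G0].
  case: unliftP => [j' _|_]; last exact: lshift_inj.
  by apply: inj_comp; [exact: rshift_inj|exact: binj].
rewrite expeS -bG//.
have mP : measurable_fun setT (fun x : n.-tuple T => (\prod_j G (reindex_tuple (b j) x))%R).
  apply: (@measurable_prod _ _ _ _ _ _ (fun j x => G (reindex_tuple (b j) x))) => j _.
  exact: (measurableT_comp mG (measurable_reindex_tuple (b j))).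
rewrite -ge0_integral_product_power_cat//; last by move=> x; exact: prodr_ge0.
apply: eq_integral => x _; congr EFin; rewrite big_ord_recl unlift_none.
congr (_ * _)%R; apply: eq_bigr => j _; rewrite liftK; congr G.
by apply: eq_from_tnth => i; rewrite !tnth_mktuple.
Qed.

End ProductPower.

(** The values are corrected one index at a time, by composing with the transposition of the current
    and the desired image; injectivity keeps both away from the images already fixed. *)
Lemma exists_perm_extending k N (le_kN : (k <= N)%N) (f : 'I_k -> 'I_N) :
  injective f -> exists s : 'S_N, forall i, s (widen_ord le_kN i) = f i.
Proof.
move=> finj.
suff H j : (j <= k)%N -> exists s : 'S_N,
    forall i : 'I_k, (i < j)%N -> s (widen_ord le_kN i) = f i.
  by have [s sf] := H k (leqnn k); exists s => i; exact: sf.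
elim: j => [|j IH] jk; first by exists 1%g.
have [s sf] := IH (ltnW jk); pose J := Ordinal jk.
exists (s * tperm (s (widen_ord le_kN J)) (f J))%g => i.
rewrite ltnS leq_eqVlt permM => /orP[/eqP ij|ij].
  have -> : i = J by exact/val_inj.
  by rewrite tpermL.
have iJ : i != J by rewrite -val_eqE /= ltn_eqF.
rewrite -(sf i)// tpermD//.
  rewrite (inj_eq perm_inj) eq_sym; apply: contra iJ => /eqP/(congr1 val) /= h.
  exact/eqP/val_inj.
by rewrite (sf i)// eq_sym (inj_eq finj).
Qed.

Section Exchangeable.
Context d (T : measurableType d) (R : realType).

(** All blocks have the law of the first one. This is how exchangeability enters the entropy
    bound. *)
Lemma exchangeable_reindex N k (le_kN : (k <= N)%N)
    (nu : probability (N.-tuple T) R) (f : 'I_k -> 'I_N) :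
  exchangeable nu -> injective f ->
  eq_measure (distribution nu (reindex_tuple f)) (distribution nu (first_coords le_kN)).
Proof.
move=> ex /(exists_perm_extending le_kN)[s sf] A mA.
have mB : measurable (@first_coords _ T _ _ le_kN @^-1` A).
  by rewrite -[X in measurable X]setTI; exact: measurable_reindex_tuple.
apply: etrans (ex s _ mB); rewrite /distribution /pushforward /=; congr (nu _).
apply/funext => x /=; congr A; apply: eq_from_tnth => i.
by rewrite !tnth_mktuple sf.
Qed.

(* Testing the duality formula against the sum of one function over disjoint
   blocks of coordinates, centred by its log-Laplace transform, superadds the
   entropies of the blocks. *)
Lemma exchangeable_relative_entropy_marginal N k m (le_kN : (k <= N)%N)
    (nu : probability (N.-tuple T) R) (mu : probability T R) :
  exchangeable nu -> (0 < m)%N -> (m * k <= N)%N ->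
  m%:R%:E * relative_entropy (distribution nu (first_coords le_kN)) (product_power mu k)
    <= relative_entropy nu (product_power mu N).
Proof.
move=> ex m0 mkN; have := relative_entropy_ge0 nu (product_power mu N).
case E : (relative_entropy nu (product_power mu N)) => [L| |] // _; last exact: leey.
have mR : (0 < m%:R :> R)%R by rewrite ltr0n.
rewrite -lee_pdivlMl//; apply: relative_entropy_le => f bf.
have [b [binj bG]] := product_power_blocks mu mkN.
set Z := (\int[_]_x expR _)%R.
have bef := bounded_measurable_expR bf.
have ZE : \int[product_power mu k]_x (expR (f x))%:E = Z%:E.
  by apply: Rintegral_EFin; exact: bounded_measurable_integrable.
have Z0 : (0 < Z)%R.
  have [_ [M fM]] := bf.
  have : (\int[product_power mu k]_x (expR (- M)) <= Z)%R.
    apply: le_Rintegral => //.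
    - exact: (bounded_measurable_integrable _ (bounded_measurable_cst _ _)).
    - exact: bounded_measurable_integrable.
    - by move=> x _; rewrite ler_expR; have := fM x; rewrite ler_norml => /andP[].
  by rewrite Rintegral_prob_cst; apply: lt_le_trans; exact: expR_gt0.
have bj j : bounded_measurable (fun x => f (reindex_tuple (b j) x)).
  exact: (bounded_measurable_comp (@measurable_reindex_tuple _ T _ _ (b j)) bf).
pose F x := (\sum_j f (reindex_tuple (b j) x) + - (m%:R * ln Z))%R.
have bS := bounded_measurable_sum bj.
have bF : bounded_measurable F.
  by apply: bounded_measurableD => //; exact: bounded_measurable_cst.
have : relative_entropy nu (product_power mu N) <= L%:E by rewrite E.
move/relative_entropy_le_dual => /(_ F bF).
have -> : (\int[product_power mu N]_x expR (F x) = 1)%R.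
  have -> : (fun x => expR (F x)) = (fun x =>
      (expR (- (m%:R * ln Z))) * \prod_j expR (f (reindex_tuple (b j) x)))%R.
    by apply/funext => x; rewrite /F expRD mulrC expR_sum.
  rewrite RintegralZl//; last first.
    have := bounded_measurable_integrable (product_power mu N) (bounded_measurable_expR bS).
    by under eq_fun do rewrite /= expR_sum.
  rewrite {1}/Rintegral (bG (fun x => expR (f x))); first last.
  - by move=> x; exact: expR_ge0.
  - by case: bef.
  rewrite ZE -EFin_expe /= mulrC -(@lnK _ Z) ?posrE//.
  rewrite expRK -expRM_natl -expRD.
  by rewrite subrr expR0.
have -> : (\int[nu]_x F x = m%:R * (\int[distribution nu (first_coords le_kN)]_x f x) - m%:R * ln Z)%R.
  rewrite RintegralD//; last 2 first.
    exact: bounded_measurable_integrable.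
    exact: (bounded_measurable_integrable _ (bounded_measurable_cst _ _)).
  rewrite Rintegral_prob_cst; congr (_ - _)%R.
  have -> : (m%:R * (\int[distribution nu (first_coords le_kN)]_x f x) =
    \sum_(j < m) \int[nu]_x f (reindex_tuple (b j) x))%R.
    rewrite -[m in LHS]card_ord -sum1_card natr_sum mulr_suml; apply: eq_bigr => j _.
    rewrite mul1r -(eq_measure_Rintegral _ (exchangeable_reindex le_kN ex (binj j))).
    exact: Rintegral_distribution.
  move: (b) bj => {}b {}bj {bG binj F bS bF mkN m0 mR}.
  elim: m b bj => [|m IH] b bj.
    by under eq_Rintegral do rewrite big_ord0; rewrite big_ord0 Rintegral_prob_cst.
  under eq_Rintegral do rewrite big_ord_recl.
  rewrite big_ord_recl RintegralD ?IH//; apply: bounded_measurable_integrable => //.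
  exact: (bounded_measurable_sum (fun j => bj (lift ord0 j))).
(* Centring yields the logarithmic form I - ln Z <= L / m; this inequality weakens it to the affine
   form I + 1 - Z that the duality lemma asks for. *)
have lnZ : (ln Z <= Z - 1)%R.
  by have := @le_ln1Dx R (Z - 1)%R; rewrite (addrC 1%R) subrK; apply; rewrite ltrBDr addNr.
move: (\int[_]_x _)%R => I HI.
suff : (m%:R * (I + 1 - Z) <= L)%R.
  by rewrite -ler_pdivlMl//; lra.
have : (m%:R * ln Z <= m%:R * (Z - 1))%R by rewrite ler_pM2l.
by lra.
Qed.

End Exchangeable.

(** * Measurability of the metric on a Polish space *)

Section PolishMeasurability.
Context d (R : realType) (E : polishType d R).

Lemma open_measurable_polish (U : set E) : open U -> measurable U.
Proof. by move=> oU; rewrite polish_borel; exact: sub_sigma_algebra. Qed.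

Lemma open_polishP (U : set E) :
  open U <-> forall x, U x -> exists2 e : R, (0 < e)%R & ball x e `<=` U.
Proof.
rewrite openE /interior; split => H x /H => [/nbhs_ballP//|[e e0 eU]].
by apply/nbhs_ballP; exists e.
Qed.

Lemma ball_open_polish (a : E) (r : R) : open (ball a r).
Proof.
apply/open_polishP => x; rewrite ballEmdist /= => axr.
exists (r - mdist a x)%R; first by rewrite subr_gt0.
move=> y; rewrite !ballEmdist /= => xy.
by apply: (le_lt_trans (metric_triangle a x y)); rewrite addrC -ltrBrDr.
Qed.

Lemma dense_sequence (o : E) : exists e : nat -> E,
  forall x (r : R), (0 < r)%R -> exists n, (mdist x (e n) < r)%R.
Proof.
have [D /countable_injP[f finj] dD] := @polish_separable d R E.
(* [o] is the default at the integers that the injection [f] of the dense set does not reach. *)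
exists (fun n => xget o [set a | D a /\ f a = n]) => x r r0.
have [| |a [xa Da]] := dD (ball x r).
- by exists x; rewrite ballEmdist /= mdistxx.
- exact: ball_open_polish.
exists (f a); case: xgetP => [b _ [Db fb]|/(_ a)]; last by case.
  rewrite (finj b a) ?inE//.
  by move: xa; rewrite ballEmdist.
Qed.

Lemma measurable_fun_ltP d' (T : measurableType d') (f : T -> R) :
  (forall r : R, measurable [set x | (f x < r)%R]) -> measurable_fun setT f.
Proof.
move=> mf; apply: (measurability _ (RGenInftyO.measurableE R)) => _ [_ [r ->] <-].
by rewrite setTI; apply: (eq_ind _ measurable (mf r)); apply/seteqP; split => x /=;
  rewrite in_itv.
Qed.

Lemma measurable_mdist_to (a : E) : measurable_fun setT (mdist a).
Proof.
apply: measurable_fun_ltP => r; have := @ball_open_polish a r.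
by rewrite ballEmdist; exact: open_measurable_polish.
Qed.

(** Separability makes the metric measurable for the product sigma-algebra: d(x,y) < r holds exactly
    when some point a of the dense sequence satisfies d(a,x) + d(a,y) < r, a countable union of
    conditions on functions of one variable. *)
Lemma measurable_mdist : measurable_fun setT (fun z : E * E => mdist z.1 z.2).
Proof.
apply: measurable_fun_ltP => r.
have [ [ o _]|/forallNP noE] := pselect (exists o : E, True); last first.
  rewrite (_ : [set _ | _] = set0)//; apply/seteqP; split => // -[x y] _.
  by case: (noE x).
have [e eD] := dense_sequence o.
rewrite (_ : [set _ | _] =
  \bigcup_n [set z : E * E | (mdist (e n) z.1 + mdist (e n) z.2 < r)%R]).
  apply: bigcup_measurable => n _.
  have mS : measurable_fun setT (fun z : E * E => (mdist (e n) z.1 + mdist (e n) z.2)%R).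
    by apply: measurable_funD; apply: (measurableT_comp (measurable_mdist_to (e n))).
  rewrite (_ : [set _ | _] = (fun z : E * E => (mdist (e n) z.1 + mdist (e n) z.2)%R) @^-1` `]-oo, r[).
    by rewrite -[X in measurable X]setTI; apply: mS => //; exact: measurable_itv.
  by apply/seteqP; split => x /=; rewrite in_itv.
apply/seteqP; split => [[x y] /= xyr|[x y] [n _] /=].
- have [|n xn] := eD x ((r - mdist x y) / 2)%R.
    by rewrite divr_gt0 ?subr_gt0.
  exists n => //=; rewrite (metric_sym (e n) x).
  have := metric_triangle (e n) x y; rewrite (metric_sym (e n) x).
  move: xn; rewrite ltr_pdivlMr//; move: (mdist _ _) (mdist _ _) (mdist _ _).
  by move=> a b c; lra.
- apply: le_lt_trans; rewrite (metric_sym (e n) x).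
  exact: metric_triangle.
Qed.

(** Reduces open sets to balls, whose indicators are limits of ramps. The [set0] branch lets the
    union range over all pairs of integers. *)
Lemma open_bigcup_balls (e : nat -> E) (U : set E) :
  (forall x (r : R), (0 < r)%R -> exists n, (mdist x (e n) < r)%R) -> open U ->
  U = \bigcup_n \bigcup_m
    (if `[< ball (e n) (m.+1%:R^-1 : R) `<=` U >] then ball (e n) (m.+1%:R^-1 : R) else set0).
Proof.
move=> eD /open_polishP oU; apply/seteqP; split => [x Ux|x [n _ [m _]]]; last first.
  by case: asboolP => // h; exact: h.
have [r r0 rU] := oU x Ux.
(* This makes 1/(m+1) < r/2, so a ball of that radius whose centre is that close to x contains x and
   lies inside the ball of radius r around x. *)
pose m := Num.truncn (2 / r)%R.
have mr : (m.+1%:R^-1 < r / 2 :> R)%R.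
  rewrite -[ltRHS]invrK ltf_pV2 ?posrE ?invr_gt0 ?divr_gt0// invf_div.
  exact: truncnS_gt.
have [|n xn] := eD x (m.+1%:R^-1 : R)%R; first by rewrite invr_gt0.
exists n => //; exists m => //; case: asboolP => [_|[]].
  by rewrite ballEmdist /= metric_sym.
move=> y; rewrite ballEmdist /= => ny; apply: rU; rewrite ballEmdist /=.
apply: (le_lt_trans (metric_triangle x (e n) y)); rewrite (splitr r).
by apply: ltrD; [exact: lt_trans xn mr|exact: lt_trans ny mr].
Qed.

End PolishMeasurability.

(** * Test functions adapted to the quadratic transport cost *)

Section TestFunctions.
Context d (R : realType) (E : polishType d R).

Definition tuple_cost n (x y : n.-tuple E) : R :=
  (\sum_(i < n) (mdist (tnth x i) (tnth y i)) ^+ 2)%R.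

Lemma tuple_cost_ge0 n (x y : n.-tuple E) : (0 <= tuple_cost x y)%R.
Proof. by apply: sumr_ge0 => i _; rewrite exprn_even_ge0. Qed.

Lemma measurable_tuple_cost n :
  measurable_fun setT (fun z : n.-tuple E * n.-tuple E => tuple_cost z.1 z.2).
Proof.
apply: (@measurable_sum _ _ _ _ _ _ (fun (i : 'I_n) (z : n.-tuple E * n.-tuple E) =>
  mdist (tnth z.1 i) (tnth z.2 i) ^+ 2)%R) => i.
apply: measurable_funX.
have mp : measurable_fun setT
    (fun z : n.-tuple E * n.-tuple E => (tnth z.1 i, tnth z.2 i)).
  apply: measurable_fun_pair.
  - exact: (measurableT_comp (measurable_tnth i) measurable_fst).
  - exact: (measurableT_comp (measurable_tnth i) measurable_snd).
exact: (measurableT_comp (@measurable_mdist d R E) mp).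
Qed.

(** A uniform continuity that can be integrated: against a coupling it bounds the difference of the
    two means by e plus C times the transport cost. Since a <= e + a^2/e, Lipschitz functions have
    it, and for bounded functions it is stable under products. *)
Definition cost_continuous n (f : n.-tuple E -> R) : Prop :=
  forall e : R, (0 < e)%R -> exists2 C : R, (0 <= C)%R &
    forall x y, (`|f x - f y| <= e + C * tuple_cost x y)%R.

Definition test_function n (f : n.-tuple E -> R) : Prop :=
  [/\ measurable_fun setT f, (forall x, 0 <= f x <= 1)%R & cost_continuous f].

Lemma test_function_bounded n (f : n.-tuple E -> R) :
  test_function f -> bounded_measurable f.
Proof.
move=> [mf f01 _]; split => //; exists 1%R => x.
by have /andP[f0 f1] := f01 x; rewrite ger0_norm.
Qed.

Lemma test_function_cst n (c : R) : (0 <= c <= 1)%R ->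
  test_function (fun _ : n.-tuple E => c).
Proof.
move=> c01; split => // e e0; exists 0%R => // x y.
by rewrite subrr normr0 mul0r addr0 ltW.
Qed.

Lemma test_functionC n (f : n.-tuple E -> R) :
  test_function f -> test_function (fun x => 1 - f x)%R.
Proof.
move=> [mf f01 cf]; split=> [|x|e /cf[C C0 fC]].
- exact: measurable_funB.
- by have := f01 x; lra.
- exists C => // x y; rewrite (_ : (1 - f x - (1 - f y) = f y - f x)%R); last by lra.
  by rewrite distrC.
Qed.

Lemma test_functionM n (f g : n.-tuple E -> R) :
  test_function f -> test_function g -> test_function (fun x => f x * g x)%R.
Proof.
move=> [mf f01 cf] [mg g01 cg]; split=> [|x|e e0].
- exact: measurable_funM.
- have /andP[f0 f1] := f01 x; have /andP[g0 g1] := g01 x.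
  by rewrite mulr_ge0// mulr_ile1.
- have e2 : (0 < e / 2)%R by rewrite divr_gt0.
  have [C C0 fC] := cf _ e2; have [C' C'0 gC] := cg _ e2.
  exists (C + C')%R => [|x y]; first exact: addr_ge0.
  rewrite (_ : (f x * g x - f y * g y =
    (f x - f y) * g x + f y * (g x - g y))%R); last by ring.
  apply: (le_trans (ler_normD _ _)); rewrite !normrM.
  have /andP[f0 f1] := f01 y; have /andP[g0 g1] := g01 x.
  rewrite (ger0_norm f0) (ger0_norm g0).
  have h1 : (`|f x - f y| * g x <= `|f x - f y|)%R by rewrite ler_piMr.
  have h2 : (f y * `|g x - g y| <= `|g x - g y|)%R by rewrite ler_piMl.
  have := fC x y; have := gC x y; move: h1 h2; rewrite mulrDl.
  move: (C * _)%R (C' * _)%R => u v.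
  by lra.
Qed.

Lemma test_function_mid n (f g : n.-tuple E -> R) :
  test_function f -> test_function g -> test_function (fun x => 2^-1 * (f x + g x))%R.
Proof.
move=> [mf f01 cf] [mg g01 cg]; split=> [|x|e e0].
- by apply: measurable_funM => //; exact: measurable_funD.
- by have := f01 x; have := g01 x; lra.
- have [C C0 fC] := cf _ e0; have [C' C'0 gC] := cg _ e0.
  exists (2^-1 * (C + C'))%R => [|x y]; first by rewrite mulr_ge0 ?addr_ge0 ?invr_ge0.
  have := fC x y; have := gC x y; rewrite -mulrBr -mulrA mulrDl normrM ger0_norm//.
  have := ler_normD (f x - f y)%R (g x - g y)%R.
  rewrite (_ : (f x + g x - (f y + g y) = f x - f y + (g x - g y))%R); last by ring.
  move: `|_ + _|%R `|f x - f y|%R `|g x - g y|%R (C * _)%R (C' * _)%R => a b c u v.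
  by lra.
Qed.

(** Dropping coordinates only lowers the cost. Hence W2-convergence on E^N acts on marginals without
    projecting couplings. *)
Lemma test_function_first_coords N k (le_kN : (k <= N)%N) (f : k.-tuple E -> R) :
  test_function f -> test_function (fun x : N.-tuple E => f (first_coords le_kN x)).
Proof.
move=> [mf f01 cf]; split=> [|x|e /cf[C C0 fC]] //.
  exact: (measurableT_comp mf (@measurable_reindex_tuple _ E _ _ (widen_ord le_kN))).
exists C => // x y; apply: (le_trans (fC _ _)); rewrite lerD2l ler_wpM2l//.
rewrite /tuple_cost.
under eq_bigr do rewrite !tnth_mktuple.
rewrite [leRHS](bigID (fun i : 'I_N => (i < k)%N))/= (big_ord_narrow le_kN) lerDl.
by apply: sumr_ge0 => i _; rewrite exprn_even_ge0.
Qed.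

Definition ramp (u : R) : R := Num.min 1%R (Num.max 0%R u).

Lemma ramp01 u : (0 <= ramp u <= 1)%R.
Proof. by rewrite /ramp ge_min lexx le_min ler01 le_max lexx. Qed.

Lemma rampP u : [\/ (u <= 0)%R /\ ramp u = 0%R, (0 <= u <= 1)%R /\ ramp u = u |
  (1 <= u)%R /\ ramp u = 1%R].
Proof.
rewrite /ramp; have [u0|/ltW u0] := leP u 0%R.
  by apply: Or31; rewrite ?max_l// min_r.
rewrite ?(max_r u0); have [u1|/ltW u1] := leP u 1%R.
  by apply: Or32; rewrite u0 ?min_r.
by apply: Or33; rewrite ?min_l.
Qed.

Lemma ramp_lipschitz u v : (`|ramp u - ramp v| <= `|u - v|)%R.
Proof.
rewrite ler_norml; have := ler_norm (u - v)%R; have := ler_norm (v - u)%R.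
rewrite (distrC v u); move: `|_|%R => w h1 h2.
by case: (rampP u) => -[] hu ->; case: (rampP v) => -[] hv ->; lra.
Qed.

(** An [m]-Lipschitz function that increases with [m] to the indicator of the open ball. *)
Definition ball_ramp (a : E) (r : R) (m : nat) (x : E) : R :=
  ramp (m%:R * (r - mdist a x))%R.

Lemma test_function_ball_ramp n (i : 'I_n) a r m :
  test_function (fun x : n.-tuple E => ball_ramp a r m (tnth x i)).
Proof.
split=> [|x|e e0]; last 1 first.
(* From w <= e + w^2/e with w = m D, where D is the distance of the i-th coordinates and m the
   Lipschitz constant. *)
- exists (m%:R ^+ 2 / e)%R => [|x y].
    by rewrite divr_ge0 ?exprn_ge0// ltW.
  set D := mdist (tnth x i) (tnth y i).
  have D0 : (0 <= D)%R by exact: mdist_ge0.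
  have Dc : (D ^+ 2 <= tuple_cost x y)%R.
    rewrite /tuple_cost (bigD1 i)//= lerDl; apply: sumr_ge0 => j _.
    by rewrite exprn_even_ge0.
  have h : (`|ball_ramp a r m (tnth x i) - ball_ramp a r m (tnth y i)| <= m%:R * D)%R.
    apply: (le_trans (ramp_lipschitz _ _)); rewrite -mulrBr normrM ger0_norm//.
    rewrite ler_wpM2l// ler_norml.
    have := metric_triangle a (tnth x i) (tnth y i).
    have := metric_triangle a (tnth y i) (tnth x i).
    rewrite (metric_sym (tnth y i)) -/D; move: (mdist _ _) (mdist _ _) D {D0 Dc} => u v D.
    by lra.
  apply: (le_trans h).
  apply: (@le_trans _ _ (e + m%:R ^+ 2 / e * D ^+ 2)%R).
    have -> : (m%:R ^+ 2 / e * D ^+ 2 = (m%:R * D) ^+ 2 / e)%R by rewrite exprMn mulrAC.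
    set w := (m%:R * D)%R; have w0 : (0 <= w)%R by rewrite mulr_ge0.
    have [we|we] := leP w e.
      by rewrite (le_trans we)// lerDl divr_ge0 ?exprn_ge0// ltW.
    apply: (@le_trans _ _ (w ^+ 2 / e)%R); last by rewrite lerDr ltW.
    by rewrite ler_pdivlMr// expr2 ler_wpM2l// ltW.
  by rewrite lerD2l ler_wpM2l// divr_ge0 ?exprn_ge0// ltW.
- apply: measurable_minr => //; apply: measurable_maxr => //.
  apply: measurable_funM => //; apply: measurable_funB => //.
  exact: (measurableT_comp (measurable_mdist_to a) (measurable_tnth i)).
- exact: ramp01.
Qed.

Lemma ball_ramp_cvg a r x :
  ball_ramp a r m x @[m --> \oo] --> (\1_(ball a r) x : R).
Proof.
rewrite indicE; case: (boolP (x \in _)) => [|/negP]; rewrite inE ballEmdist/= => axr.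
  apply: cvg_near_cst; near=> m; rewrite /ball_ramp /ramp.
  have : (1 <= m%:R * (r - mdist a x))%R.
    rewrite -ler_pdivrMr ?subr_gt0// mul1r; near: m; exact: nbhs_infty_ger.
  move=> h; rewrite max_r ?min_l// (le_trans _ h)//.
apply: cvg_near_cst; near=> m; rewrite /ball_ramp /ramp.
have h : (m%:R * (r - mdist a x) <= 0)%R.
  by rewrite mulr_ge0_le0// subr_le0 leNgt; apply/negP.
by rewrite max_l// min_r.
Unshelve. all: by end_near. Qed.

End TestFunctions.

(** * Density of the test functions in L^1 of two measures *)

Section L1Distance.
Context d (T : measurableType d) (R : realType) (eta1 eta2 : probability T R).
Implicit Types f g : T -> R.

Lemma bounded_measurableB f g : bounded_measurable f -> bounded_measurable g ->
  bounded_measurable (fun x => (f x - g x)%R).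
Proof.
move=> [mf [M fM]] [mg [M' gM]]; split; first exact: measurable_funB.
by exists (M + M')%R => x; apply: (le_trans (ler_normB _ _)); exact: lerD.
Qed.

Lemma bounded_measurable_norm f : bounded_measurable f ->
  bounded_measurable (fun x => `|f x|%R).
Proof.
move=> [mf [M fM]]; split; first exact: measurableT_comp.
by exists M => x; rewrite normr_id.
Qed.

Lemma bounded_measurable_indic A : measurable A ->
  bounded_measurable (\1_A : T -> R).
Proof.
move=> mA; split; first exact: measurable_indic.
by exists 1%R => x; rewrite indicE; case: (_ \in _); rewrite ?normr1 ?normr0.
Qed.

(* Two measures at once, since the duality formula tests [f] against one measure
   and [expR \o f] against the other. *)
Definition L1_dist f g : R :=
  ((\int[eta1]_x `|f x - g x|) + (\int[eta2]_x `|f x - g x|))%R.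

Lemma L1_dist_le f g f' g' :
  bounded_measurable f -> bounded_measurable g ->
  bounded_measurable f' -> bounded_measurable g' ->
  (forall x, `|f x - g x| <= `|f' x - g' x|)%R -> (L1_dist f g <= L1_dist f' g')%R.
Proof.
move=> bf bg bf' bg' H.
by apply: lerD; apply: le_Rintegral => //; apply: bounded_measurable_integrable;
  apply: bounded_measurable_norm; exact: bounded_measurableB.
Qed.

Lemma L1_dist_scaleD_le c f g f1 g1 f2 g2 :
  bounded_measurable f -> bounded_measurable g ->
  bounded_measurable f1 -> bounded_measurable g1 ->
  bounded_measurable f2 -> bounded_measurable g2 ->
  (forall x, `|f x - g x| <= c * (`|f1 x - g1 x| + `|f2 x - g2 x|))%R ->
  (L1_dist f g <= c * (L1_dist f1 g1 + L1_dist f2 g2))%R.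
Proof.
move=> bf bg bf1 bg1 bf2 bg2 H; rewrite /L1_dist addrACA mulrDr.
have bD (u v : T -> R) : bounded_measurable u -> bounded_measurable v ->
    bounded_measurable (fun x => `|u x - v x|%R).
  by move=> bu bv; apply: bounded_measurable_norm; exact: bounded_measurableB.
have bi (eta : probability T R) u v : bounded_measurable u -> bounded_measurable v ->
    eta.-integrable setT (EFin \o (fun x => `|u x - v x|%R)).
  by move=> bu bv; apply: bounded_measurable_integrable; exact: bD.
have bS := bounded_measurableD (bD _ _ bf1 bg1) (bD _ _ bf2 bg2).
have step (eta : probability T R) : (\int[eta]_x `|f x - g x| <=
    c * (\int[eta]_x `|f1 x - g1 x| + \int[eta]_x `|f2 x - g2 x|))%R.
  rewrite -RintegralD; [|exact: measurableT|exact: bi|exact: bi].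
  rewrite -RintegralZl; [|exact: measurableT|exact: bounded_measurable_integrable].
  apply: le_Rintegral => //; first exact: bi.
  apply: bounded_measurable_integrable; apply: bounded_measurableM => //.
  exact: bounded_measurable_cst.
by apply: lerD.
Qed.

Lemma L1_distD_le f g f1 g1 f2 g2 :
  bounded_measurable f -> bounded_measurable g ->
  bounded_measurable f1 -> bounded_measurable g1 ->
  bounded_measurable f2 -> bounded_measurable g2 ->
  (forall x, `|f x - g x| <= `|f1 x - g1 x| + `|f2 x - g2 x|)%R ->
  (L1_dist f g <= L1_dist f1 g1 + L1_dist f2 g2)%R.
Proof.
move=> bf bg bf1 bg1 bf2 bg2 H; rewrite -[leRHS]mul1r.
by apply: L1_dist_scaleD_le => // x; rewrite mul1r.
Qed.

Lemma Rintegral_bounded_cvg (eta : probability T R) (f_ : nat -> T -> R) f (M : R) :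
  (forall n, measurable_fun setT (f_ n)) -> measurable_fun setT f ->
  (forall n x, `|f_ n x| <= M)%R -> (forall x, f_ n x @[n --> \oo] --> f x) ->
  (\int[eta]_x f_ n x)%R @[n --> \oo] --> (\int[eta]_x f x)%R.
Proof.
move=> mf_ mf fM cf.
have [] := @dominated_convergence _ _ _ eta setT measurableT
  (fun n => EFin \o f_ n) (EFin \o f) (cst M%:E).
- by move=> n; exact/measurable_EFinP.
- exact/measurable_EFinP.
- by apply: aeW => x _; apply: cvg_EFin; [near=> n|exact: cf].
- exact: (bounded_measurable_integrable eta (bounded_measurable_cst T M)).
- by apply: aeW => x n _ /=; rewrite lee_fin.
move=> fi _ cv; apply: fine_cvg.
by rewrite -Rintegral_EFin.
Unshelve. all: by end_near. Qed.

Lemma L1_dist_indic_bigcup (A : nat -> set T) (e : R) :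
  (forall n, measurable (A n)) -> (0 < e)%R ->
  exists n, (L1_dist \1_(\bigcup_n A n) \1_(\bigcup_(i < n) A i) < e)%R.
Proof.
move=> mA e0.
have mB n : measurable (\bigcup_(i < n) A i) by apply: bigcup_measurable.
have mU : measurable (\bigcup_n A n) by exact: bigcup_measurable.
pose h n x : R := `|\1_(\bigcup_n A n) x - \1_(\bigcup_(i < n) A i) x|%R.
have ch (eta : probability T R) : (\int[eta]_x h n x)%R @[n --> \oo] --> (0%R : R).
  rewrite -[X in _ --> X](Rintegral_prob_cst eta 0%R).
  apply: (@Rintegral_bounded_cvg _ _ _ 1%R) => //.
  - move=> n; apply: measurableT_comp => //.
    by apply: measurable_funB; exact: measurable_indic.
  - move=> n x; rewrite /h !indicE normr_id.
    by case: (_ \in _); case: (_ \in _); rewrite ?subrr ?subr0 ?sub0r ?normrN ?normr1 ?normr0.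
  - move=> x; apply: cvg_near_cst; rewrite /h.
    have [[m _ Am]|nU] := pselect ((\bigcup_n A n) x); last first.
      near=> n; rewrite !indicE !memNset ?subrr ?normr0//.
      by move=> [i _ Ai]; apply: nU; exists i.
    near=> n; rewrite !indicE !mem_set ?subrr ?normr0//; last by exists m.
    by exists m => //=; near: n; exact: nbhs_infty_gt.
have e2 : (0 < e / 2)%R by rewrite divr_gt0.
have /cvgrPdist_lt/(_ _ e2) near1 := ch eta1.
have /cvgrPdist_lt/(_ _ e2) near2 := ch eta2.
near \oo => n; exists n.
have : (`|0 - \int[eta1]_x h n x| < e / 2)%R by near: n.
have : (`|0 - \int[eta2]_x h n x| < e / 2)%R by near: n.
rewrite !sub0r !normrN => h2 h1; rewrite (splitr e); apply: ltrD.
- exact: le_lt_trans (ler_norm _) h1.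
- exact: le_lt_trans (ler_norm _) h2.
Unshelve. all: by end_near. Qed.

End L1Distance.

Section Approximation.
Context d (R : realType) (E : polishType d R) (n : nat).
Variables eta1 eta2 : probability (n.-tuple E) R.
Local Notation dist := (L1_dist eta1 eta2).

(** Measurability belongs to the property so that an induction over a generated sigma-algebra
    carries it along: the closure steps integrate indicators of the sets involved. *)
Definition approximable (A : set (n.-tuple E)) : Prop := measurable A /\
  forall e : R, (0 < e)%R -> exists2 f, test_function f & (dist \1_A f <= e)%R.

Lemma L1_dist_triangle (f g h : n.-tuple E -> R) :
  bounded_measurable f -> bounded_measurable g -> bounded_measurable h ->
  (dist f h <= dist f g + dist g h)%R.
Proof. by move=> bf bg bh; apply: L1_distD_le => // x; exact: ler_distD. Qed.

Lemma approximable0 : approximable set0.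
Proof.
split => // e e0; exists (cst 0%R).
  by apply: test_function_cst; rewrite lexx ler01.
rewrite /L1_dist; under eq_Rintegral do rewrite indic0 /= subrr normr0.
rewrite Rintegral_prob_cst; under eq_Rintegral do rewrite indic0 /= subrr normr0.
by rewrite Rintegral_prob_cst addr0 ltW.
Qed.

Lemma approximableC A : approximable A -> approximable (~` A).
Proof.
move=> [mA aA]; split => [|e /aA[f tf fA]]; first exact: measurableC.
exists (fun x => 1 - f x)%R; first exact: test_functionC.
apply: le_trans fA; apply: L1_dist_le.
- by apply: bounded_measurable_indic; exact: measurableC.
- by apply: test_function_bounded; exact: test_functionC.
- exact: bounded_measurable_indic.
- exact: test_function_bounded.
move=> x; rewrite indicC indicE; case: (x \in A) => /=.
  by rewrite sub0r opprB distrC.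
by rewrite opprB addrCA subrr addr0 sub0r normrN.
Qed.

Lemma approximableI A B : approximable A -> approximable B -> approximable (A `&` B).
Proof.
move=> [mA aA] [mB aB]; split => [|e e0]; first exact: measurableI.
have e2 : (0 < e / 2)%R by rewrite divr_gt0.
have [f tf fA] := aA _ e2; have [g tg gB] := aB _ e2.
exists (fun x => f x * g x)%R; first exact: test_functionM.
rewrite (splitr e); apply: le_trans (lerD fA gB); apply: L1_distD_le.
- by apply: bounded_measurable_indic; exact: measurableI.
- by apply: test_function_bounded; exact: test_functionM.
- exact: bounded_measurable_indic.
- exact: test_function_bounded.
- exact: bounded_measurable_indic.
- exact: test_function_bounded.
move=> x; rewrite indicI /=.
rewrite (_ : (\1_A x * \1_B x - f x * g x =
    (\1_A x - f x) * \1_B x + f x * (\1_B x - g x))%R); last by ring.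
have [_ /(_ x)/andP[f0 f1] _] := tf.
apply: (le_trans (ler_normD _ _)); rewrite !normrM (ger0_norm f0); apply: lerD.
  rewrite ler_piMr// indicE; case: (_ \in _); rewrite ?normr1 ?normr0//.
by rewrite ler_piMl.
Qed.

Lemma approximableU A B : approximable A -> approximable B -> approximable (A `|` B).
Proof.
move=> aA aB; rewrite -[_ `|` _]setCK setCU.
by apply: approximableC; apply: approximableI; exact: approximableC.
Qed.

Lemma approximable_bigcup (A : nat -> set (n.-tuple E)) :
  (forall i, approximable (A i)) -> approximable (\bigcup_i A i).
Proof.
move=> aA.
have mA i : measurable (A i) by have [] := aA i.
have mB m : measurable (\bigcup_(i < m) A i) by apply: bigcup_measurable.
have aB m : approximable (\bigcup_(i < m) A i).
  rewrite bigcup_mkord; elim: m => [|m IH].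
    by rewrite big_ord0; exact: approximable0.
  by rewrite big_ord_recr; exact: approximableU.
have mU : measurable (\bigcup_i A i) by exact: bigcup_measurable.
split => // e e0; have e2 : (0 < e / 2)%R by rewrite divr_gt0.
have [m mAe] := L1_dist_indic_bigcup eta1 eta2 mA e2.
have [_ /(_ _ e2)[f tf fB]] := aB m.
exists f => //; apply: le_trans (L1_dist_triangle
  (bounded_measurable_indic _ mU) (bounded_measurable_indic _ (mB m))
  (test_function_bounded tf)) _.
by rewrite (splitr e); apply: lerD => //; exact: ltW.
Qed.

Lemma approximable_ball (i : 'I_n) a (r : R) :
  approximable ((fun x => tnth x i) @^-1` ball a r).
Proof.
have mb : measurable (ball a r : set E).
  by apply: open_measurable_polish; exact: ball_open_polish.
have mA : measurable ((fun x : n.-tuple E => tnth x i) @^-1` ball a r).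
  by rewrite -[X in measurable X]setTI; exact: measurable_tnth.
split=> // e e0.
pose f m := fun x : n.-tuple E => ball_ramp a r m (tnth x i).
have tf m : test_function (f m) by exact: test_function_ball_ramp.
pose h m x : R := `|\1_((fun x : n.-tuple E => tnth x i) @^-1` ball a r) x - f m x|%R.
have ch (eta : probability (n.-tuple E) R) : (\int[eta]_x h m x)%R @[m --> \oo] --> (0%R : R).
  rewrite -[X in _ --> X](Rintegral_prob_cst eta 0%R).
  apply: (@Rintegral_bounded_cvg _ _ _ _ _ _ 1%R) => //.
  - move=> m; apply: measurableT_comp => //; apply: measurable_funB.
      exact: measurable_indic.
    by case: (tf m).
  - move=> m x; rewrite /h normr_id; have [_ /(_ x)/andP[f0 f1] _] := tf m.
    by rewrite indicE; case: (_ \in _) => /=; rewrite ler_norml; lra.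
  - move=> x; rewrite /h -[X in _ --> X](@normr0 R R).
    apply: cvg_norm; rewrite -[X in _ --> X](subrr (\1_(ball a r) (tnth x i))).
    by apply: cvgB; [exact: cvg_cst|exact: ball_ramp_cvg].
have e2 : (0 < e / 2)%R by rewrite divr_gt0.
have /cvgrPdist_lt/(_ _ e2) near1 := ch eta1.
have /cvgrPdist_lt/(_ _ e2) near2 := ch eta2.
near \oo => m; exists (f m) => //.
have : (`|0 - \int[eta1]_x h m x| < e / 2)%R by near: m.
have : (`|0 - \int[eta2]_x h m x| < e / 2)%R by near: m.
rewrite !sub0r !normrN => h2 h1; rewrite (splitr e); apply: lerD.
- exact: le_trans (ler_norm _) (ltW h1).
- exact: le_trans (ler_norm _) (ltW h2).
Unshelve. all: by end_near. Qed.

Lemma approximable_open (i : 'I_n) (U : set E) :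
  open U -> approximable ((fun x => tnth x i) @^-1` U).
Proof.
have [ [ o' _]|/forallNP noE] := pselect (exists o : E, True); last first.
  move=> _; rewrite (_ : _ @^-1` _ = set0); first exact: approximable0.
  by apply/seteqP; split => // x _; case: (noE (tnth x i)).
have [e eD] := dense_sequence o'.
move=> /(open_bigcup_balls eD) ->.
rewrite preimage_bigcup; apply: approximable_bigcup => j.
rewrite preimage_bigcup; apply: approximable_bigcup => m.
by case: asboolP => _; [exact: approximable_ball|rewrite preimage_set0; exact: approximable0].
Qed.

(** Approximable sets form a sigma-algebra, so generators suffice. Generation is used twice: tuples
    are generated by coordinate preimages of measurable sets, and, for a fixed coordinate, the Borel
    sets of E by the open ones. *)
Lemma measurable_approximable A : measurable A -> approximable A.
Proof.
apply: smallest_sub => /=.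
  split=> [|B aB|F aF]; first exact: approximable0.
  - by rewrite setTD; exact: approximableC.
  - exact: approximable_bigcup.
apply: (big_ind (fun G => G `<=` approximable)) => [//|G H GA HA|i _ _ [B mB <-]].
  by rewrite subUset.
rewrite setTI; move: B mB; rewrite polish_borel.
apply: (@smallest_sub _ _ _ [set B | approximable ((fun x => tnth x i) @^-1` B)]).
  split=> [|B /= aB|F /= aF] /=.
  - by rewrite preimage_set0; exact: approximable0.
  - by rewrite setTD preimage_setC; exact: approximableC.
  - by rewrite preimage_bigcup; exact: approximable_bigcup.
by move=> U oU; exact: approximable_open.
Qed.

(* Peeling off the leading binary digit 1_{u >= 1/2} leaves a remainder
   2u - 1_{u >= 1/2} that is again [0,1]-valued. *)
Lemma test_function_dense (u : n.-tuple E -> R) (e : R) :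
  measurable_fun setT u -> (forall x, 0 <= u x <= 1)%R -> (0 < e)%R ->
  exists2 phi, test_function phi & (dist u phi <= e)%R.
Proof.
move=> mu u01 e0; have e2 : (0 < e / 2)%R by rewrite divr_gt0.
have b01 (v : n.-tuple E -> R) : measurable_fun setT v ->
    (forall x, 0 <= v x <= 1)%R -> bounded_measurable v.
  by move=> mv v01; split => //; exists 1%R => x; rewrite ler_norml; have := v01 x; lra.
(* The bound reproduces itself: the mean of e/2, for the digit, and e/2 + 2 * 2^-m, for the
   remainder, taken as half their sum, adds up to e/2 + 2 * 2^-(m+1). The 2 at m = 0 counts the two
   probability measures. *)
have H m : forall v : n.-tuple E -> R, measurable_fun setT v -> (forall x, 0 <= v x <= 1)%R ->
    exists2 phi, test_function phi & (dist v phi <= e / 2 + 2 * 2^-1 ^+ m)%R.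
  elim: m => [|m IH] v mv v01.
    exists (fun=> 0%R); first by apply: test_function_cst; rewrite lexx ler01.
    rewrite expr0 mulr1 -[leLHS]add0r; apply: lerD; first exact: ltW.
    have h (eta : probability (n.-tuple E) R) : (\int[eta]_x `|v x - 0| <= 1)%R.
      rewrite -[leRHS](Rintegral_prob_cst eta); apply: le_Rintegral => //.
      - apply: bounded_measurable_integrable; apply: bounded_measurable_norm.
        apply: bounded_measurableB; first exact: b01.
        exact: bounded_measurable_cst.
      - exact: (bounded_measurable_integrable _ (bounded_measurable_cst _ _)).
      - by move=> x _; rewrite subr0 ler_norml; have := v01 x; lra.
    by rewrite /L1_dist -[2%R]/(1 + 1)%R; apply: lerD.
  pose A := [set x | (2^-1 <= v x)%R].
  have mA : measurable A.
    rewrite (_ : A = v @^-1` `[2^-1%R, +oo[).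
      by rewrite -[X in measurable X]setTI; apply: mv => //; exact: measurable_itv.
    by apply/seteqP; split => x /=; rewrite in_itv /= andbT.
  pose w x := (2 * v x - \1_A x)%R.
  have mw : measurable_fun setT w.
    by apply: measurable_funB; [exact: measurable_funM|exact: measurable_indic].
  have w01 x : (0 <= w x <= 1)%R.
    rewrite /w indicE; case: (boolP (x \in A)) => [|/negP]; rewrite inE /A /=.
      by have := v01 x; lra.
    by move=> /negP; rewrite -ltNge; have := v01 x; lra.
  have [phi tphi wphi] := IH w mw w01.
  have [_ /(_ _ e2)[g tg gA]] := measurable_approximable mA.
  exists (fun x => 2^-1 * (g x + phi x))%R; first exact: test_function_mid.
  apply: (@le_trans _ _ (2^-1 * (dist \1_A g + dist w phi))%R).
    apply: L1_dist_scaleD_le.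
    - exact: b01.
    - by apply: test_function_bounded; exact: test_function_mid.
    - exact: bounded_measurable_indic.
    - exact: test_function_bounded.
    - exact: b01.
    - exact: test_function_bounded.
    move=> x; have := ler_normD (\1_A x - g x)%R (w x - phi x)%R.
    rewrite (_ : (\1_A x - g x + (w x - phi x) =
      2 * (v x - 2^-1 * (g x + phi x)))%R); last by rewrite /w; field.
    by rewrite normrM ger0_norm//; lra.
  rewrite exprS; move: (2^-1 ^+ m)%R wphi => a wphi; lra.
have /cvgrPdist_lt/(_ _ e2) near1 : (2 * 2^-1 ^+ m)%R @[m --> \oo] --> (0%R : R).
  rewrite -[X in _ --> X](@mulr0 R 2%R); apply: cvgM; first exact: cvg_cst.
  apply: cvg_expr.
  by rewrite ger0_norm// invf_lt1// ltr1n.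
near \oo => m; have [phi tphi uphi] := H m u mu u01.
exists phi => //; apply: (le_trans uphi); rewrite [leRHS](splitr e) lerD2l.
have : (`|0 - 2 * 2^-1 ^+ m| < e / 2)%R by near: m.
by rewrite sub0r normrN => /ltW; apply: le_trans; exact: ler_norm.
Unshelve. all: by end_near. Qed.

End Approximation.

HB.instance Definition _ d1 d2 (T1 : measurableType d1) (T2 : measurableType d2) :=
  isMeasurableFun.Build _ _ (T1 * T2)%type T1 (@fst T1 T2) measurable_fst.

HB.instance Definition _ d1 d2 (T1 : measurableType d1) (T2 : measurableType d2) :=
  isMeasurableFun.Build _ _ (T1 * T2)%type T2 (@snd T1 T2) measurable_snd.

(** * Wasserstein convergence and lower semicontinuity of the entropy *)

Section WassersteinConvergence.
Context d (R : realType) (E : polishType d R).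

Lemma W2_lt_coupling n (mu nu : probability (n.-tuple E) R) (r : R) :
  W2 mu nu < r%:E -> exists2 pi, coupling mu nu pi &
    \int[pi]_z (tuple_cost z.1 z.2)%:E <= (r ^+ 2)%:E.
Proof.
move=> /ereal_inf_lt[_ [pi cpi <-] Ir]; exists pi => //.
have I0 : 0 <= \int[pi]_z (tuple_cost z.1 z.2)%:E.
  by apply: integral_ge0 => z _; rewrite lee_fin tuple_cost_ge0.
move: Ir; rewrite -/(tuple_cost _ _) poweR12_sqrt//.
move: (\int[pi]_z _) I0 => [s| |]//; rewrite !lee_fin lte_fin => s0 sr.
by rewrite -(sqr_sqrtr s0) lerXn2r ?nnegrE ?sqrtr_ge0 ?ltW// (le_lt_trans (sqrtr_ge0 s)).
Qed.

Lemma coupling_fst n (mu nu : probability (n.-tuple E) R) pi (f : n.-tuple E -> R) :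
  coupling mu nu pi -> bounded_measurable f ->
  (\int[mu]_x f x = \int[pi]_z f z.1)%R.
Proof.
move=> cpi bf; rewrite -(@Rintegral_distribution _ _ _ _ _ pi
  (@fst _ _ : {mfun (n.-tuple E * n.-tuple E)%type >-> n.-tuple E}) f bf).
apply: eq_measure_Rintegral => A mA; have [<- _] := cpi A mA.
by congr (pi _); apply/seteqP; split => x; rewrite /setX /=; tauto.
Qed.

Lemma coupling_snd n (mu nu : probability (n.-tuple E) R) pi (f : n.-tuple E -> R) :
  coupling mu nu pi -> bounded_measurable f ->
  (\int[nu]_x f x = \int[pi]_z f z.2)%R.
Proof.
move=> cpi bf; rewrite -(@Rintegral_distribution _ _ _ _ _ pi
  (@snd _ _ : {mfun (n.-tuple E * n.-tuple E)%type >-> n.-tuple E}) f bf).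
apply: eq_measure_Rintegral => A mA; have [_ <-] := cpi A mA.
by congr (pi _); apply/seteqP; split => x; rewrite /setX /=; tauto.
Qed.

(** The modulus of [phi] is integrated along a coupling whose cost is at most r^2; the definition of
    W2 as an infimum supplies one, optimal or not. *)
Lemma W2_test_function n (mu : probability (n.-tuple E) R) (phi : n.-tuple E -> R)
    (e : R) :
  test_function phi -> (0 < e)%R -> exists2 r : R, (0 < r)%R &
  forall nu, W2 nu mu < r%:E -> (`|\int[nu]_x phi x - \int[mu]_x phi x| <= e)%R.
Proof.
move=> tphi e0; have bphi := test_function_bounded tphi.
have e2 : (0 < e / 2)%R by rewrite divr_gt0.
have [mphi _ /(_ _ e2)[C C0 phiC]] := tphi.
have C1 : (0 < C + 1)%R by rewrite ltr_wpDl.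
(* As r <= 1, C r^2 <= (C + 1) r <= e/2; the added 1 avoids a division by zero. *)
pose r := Num.min 1%R (e / 2 / (C + 1))%R.
have r0 : (0 < r)%R by rewrite lt_min ltr01 divr_gt0.
have Cr : (C * r ^+ 2 <= e / 2)%R.
  apply: (@le_trans _ _ ((C + 1) * r)%R); last first.
    by rewrite mulrC -ler_pdivlMr// /r ge_min lexx orbT.
  apply: ler_pM => //; first exact: sqr_ge0.
    by rewrite lerDl.
  by rewrite expr2 ler_piMr ?(ltW r0)// /r ge_min lexx.
exists r => // nu /W2_lt_coupling[pi cpi Ir].
have bf : bounded_measurable (fun z : n.-tuple E * n.-tuple E => phi z.1).
  exact: (bounded_measurable_comp measurable_fst bphi).
have bs : bounded_measurable (fun z : n.-tuple E * n.-tuple E => phi z.2).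
  exact: (bounded_measurable_comp measurable_snd bphi).
rewrite (coupling_fst cpi bphi) (coupling_snd cpi bphi).
rewrite -RintegralB//; [|exact: bounded_measurable_integrable..].
apply: (le_trans (le_normr_Rintegral _ _)) => //.
  by apply: bounded_measurable_integrable; exact: bounded_measurableB.
have bn := bounded_measurable_norm (bounded_measurableB bf bs).
rewrite -lee_fin -Rintegral_EFin; last exact: bounded_measurable_integrable.
apply: (@le_trans _ _ (\int[pi]_z ((e / 2)%:E + C%:E * (tuple_cost z.1 z.2)%:E))).
  apply: ge0_le_integral => //.
  - by apply/measurable_EFinP; case: bn.
  - apply: emeasurable_funD => //; apply: emeasurable_funM => //.
    by apply/measurable_EFinP; exact: measurable_tuple_cost.
  - by move=> z _; rewrite -EFinM -EFinD lee_fin.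
have mc : measurable_fun setT (fun z : n.-tuple E * n.-tuple E => (tuple_cost z.1 z.2)%:E).
  by apply/measurable_EFinP; exact: measurable_tuple_cost.
rewrite ge0_integralD//; last 3 first.
- by move=> z _; rewrite lee_fin ltW.
- by move=> z _; rewrite -EFinM lee_fin mulr_ge0// tuple_cost_ge0.
- exact: emeasurable_funM.
rewrite integral_prob_cst ge0_integralZl//; last first.
  by move=> z _; rewrite lee_fin tuple_cost_ge0.
apply: (@le_trans _ _ ((e / 2)%:E + C%:E * (r ^+ 2)%:E)).
  by rewrite leeD2l// lee_wpmul2l// lee_fin.
by rewrite -EFinM -EFinD lee_fin [leRHS](splitr e) lerD2l.
Qed.

Lemma expR_lipschitz (M x y : R) : (x <= M)%R -> (y <= M)%R ->
  (`|expR x - expR y| <= expR M * `|x - y|)%R.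
Proof.
have key a b : (a <= b)%R -> (b <= M)%R -> (expR b - expR a <= expR M * (b - a))%R.
  move=> ab bM; have h : (expR b - expR a = expR b * (1 - expR (a - b)))%R.
    by rewrite mulrBr mulr1 -expRD addrCA subrr addr0.
  rewrite h; apply: ler_pM; rewrite ?expR_ge0 ?ler_expR//.
    by rewrite subr_ge0 -expR0 ler_expR subr_le0.
  by have := expR_ge1Dx (a - b)%R; lra.
move=> xM yM; have [xy|/ltW yx] := leP x y.
  rewrite distrC (distrC x) !ger0_norm ?subr_ge0 ?ler_expR//; exact: key.
by rewrite !ger0_norm ?subr_ge0 ?ler_expR//; exact: key.
Qed.

(** The arithmetic of the next lemma, with integrals as atoms: [pn] and [pm] are the means of the
    test function under the approximating and the limiting marginal, [um] that of the rescaled [f];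
    [a] and [b] are the L^1 errors under the limiting marginal and the reference measure; [X] and
    [Y] are the exponential integrals of the approximant and of [f]. *)
Lemma lsc_estimate (M c L e e' pn pm um a b X Y : R) :
  (0 <= M)%R -> (0 <= c)%R -> (2 * M * pn - M + 1 <= L + e' + X)%R ->
  (`|pn - pm| <= e')%R -> (um - pm <= a)%R -> (a + b <= e')%R ->
  (0 <= a)%R -> (0 <= b)%R -> (X - Y <= 2 * M * c * b)%R ->
  ((1 + 2 * M + 2 * M + 2 * M * c) * e' = e)%R ->
  (2 * M * um - M + 1 <= L + Y + e)%R.
Proof.
move=> M0 c0 dual; rewrite ler_norml => /andP[h1 h2] h3 h4 a0 b0 h5 <-.
have hu : (um <= pn + e' + e')%R by lra.
have be : (b <= e')%R by lra.
have k1 := ler_wpM2l M0 hu.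
have k2 := ler_wpM2l (mulr_ge0 M0 c0) be.
by lra.
Qed.

(* Lower semicontinuity of the marginal entropy. The variational formula is
   closed under limits along test functions, and these are dense for the two
   limiting measures. *)
Lemma relative_entropy_lsc N k (le_kN : (k <= N)%N) (mu : probability (N.-tuple E) R)
    (eta : probability (k.-tuple E) R) (L : R) :
  (forall r L' : R, (0 < r)%R -> (L < L')%R -> exists2 nu : probability (N.-tuple E) R,
     W2 nu mu < r%:E &
     relative_entropy (distribution nu (first_coords le_kN)) eta <= L'%:E) ->
  relative_entropy (distribution mu (first_coords le_kN)) eta <= L%:E.
Proof.
move=> H; apply: relative_entropy_le => f bf.
set muk := distribution mu (first_coords le_kN).
have [mf [M0 fM0]] := bf.
(* The added 1 keeps M positive, so that f can be rescaled from [-M, M] to [0, 1]. *)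
pose M : R := (`|M0| + 1)%R.
have M_gt0 : (0 < M)%R by rewrite ltr_wpDl.
have fM x : (`|f x| <= M)%R.
  by rewrite (le_trans (fM0 x))// /M (le_trans (ler_norm M0))// lerDl.
have M2 : (0 < 2 * M)%R by rewrite mulr_gt0.
pose u x := ((f x + M) / (2 * M))%R.
have u01 x : (0 <= u x <= 1)%R.
  have := fM x; rewrite ler_norml => /andP[h1 h2].
  rewrite /u divr_ge0 ?(ltW M2)//=; last by lra.
  by rewrite ler_pdivrMr// mul1r; lra.
have mu_ : measurable_fun setT u.
  by apply: measurable_funM => //; exact: measurable_funD.
have fE x : f x = (2 * M * u x - M)%R.
  by rewrite /u mulrCA divff ?gt_eqF// mulr1 addrK.
apply/ler_addgt0Pr => e e0.
(* One term per error: the slack in L', the two errors in the mean of f (approximant for f,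
   approximating law for the limit), each scaled by 2M, and the error in the exponential integral,
   where e^M is a Lipschitz constant of the exponential on values at most M. *)
pose K := (1 + 2 * M + 2 * M + 2 * M * expR M)%R.
have K0 : (0 < K)%R by rewrite /K !addr_gt0// mulr_gt0// expR_gt0.
pose e' := (e / K)%R; have e'0 : (0 < e')%R by rewrite divr_gt0.
have [phi tphi uphi] := test_function_dense muk eta mu_ u01 e'0.
have bphi := test_function_bounded tphi.
pose psi x := (2 * M * phi x + - M)%R.
have bpsi : bounded_measurable psi.
  apply: bounded_measurableD; last exact: bounded_measurable_cst.
  by apply: bounded_measurableM => //; exact: bounded_measurable_cst.
have [r r0 rP] := W2_test_function mu (test_function_first_coords le_kN tphi) e'0.
have [nu Wnu Entnu] := H r (L + e')%R r0 (ltac:(by rewrite ltrDl)).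
have dual := relative_entropy_le_dual Entnu bpsi.
have affine (m : probability (k.-tuple E) R) :
    (\int[m]_x psi x = 2 * M * (\int[m]_x phi x) - M)%R.
  have b1 : bounded_measurable (fun x => 2 * M * phi x)%R.
    by apply: bounded_measurableM => //; exact: bounded_measurable_cst.
  rewrite RintegralD//; last 2 first.
    exact: bounded_measurable_integrable.
    exact: (bounded_measurable_integrable _ (bounded_measurable_cst _ _)).
  rewrite Rintegral_prob_cst RintegralZl//.
  exact: bounded_measurable_integrable.
have bu : bounded_measurable u.
  by split => //; exists 1%R => x; rewrite ler_norml; have := u01 x; lra.
have affinef : (\int[muk]_x f x = 2 * M * (\int[muk]_x u x) - M)%R.
  have b1 : bounded_measurable (fun x => 2 * M * u x)%R.
    by apply: bounded_measurableM => //; exact: bounded_measurable_cst.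
  under eq_Rintegral do rewrite fE.
  rewrite RintegralB//; last 2 first.
    exact: bounded_measurable_integrable.
    exact: (bounded_measurable_integrable _ (bounded_measurable_cst _ _)).
  rewrite Rintegral_prob_cst RintegralZl//.
  exact: bounded_measurable_integrable.
have bup := bounded_measurable_norm (bounded_measurableB bu bphi).
have dmuk : (\int[muk]_x u x - \int[muk]_x phi x <= \int[muk]_x `|u x - phi x|)%R.
  rewrite -RintegralB//; [|exact: bounded_measurable_integrable..].
  apply: le_Rintegral => //.
  - by apply: bounded_measurable_integrable; exact: bounded_measurableB.
  - exact: bounded_measurable_integrable.
  - by move=> x _; exact: ler_norm.
have be := bounded_measurable_expR bf.
have bep := bounded_measurable_expR bpsi.
have deta : (\int[eta]_x expR (psi x) - \int[eta]_x expR (f x) <=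
    2 * M * expR M * \int[eta]_x `|u x - phi x|)%R.
  rewrite -RintegralB//; [|exact: bounded_measurable_integrable..].
  rewrite -RintegralZl//; last exact: bounded_measurable_integrable.
  apply: le_Rintegral => //.
  - by apply: bounded_measurable_integrable; exact: bounded_measurableB.
  - apply: bounded_measurable_integrable; apply: bounded_measurableM => //.
    exact: bounded_measurable_cst.
  - move=> x _; apply: (le_trans (ler_norm _)).
    apply: (le_trans (@expR_lipschitz M _ _ _ _)).
    + rewrite /psi; have [_ /(_ x)/andP[_ p1] _] := tphi.
      by rewrite lerBlDr -(mulr2n M) -[leRHS]mulr_natl ler_piMr// ltW.
    + exact: le_trans (ler_norm _) (fM x).
    + rewrite fE /psi [(_ - (_ - _))%R](_ : _ = 2 * M * (phi x - u x))%R; last by ring.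
      rewrite normrM (ger0_norm (ltW M2)) distrC.
      by rewrite mulrCA mulrA.
have I1 : (0 <= \int[muk]_x `|u x - phi x|)%R by exact: Rintegral_ge0.
have I2 : (0 <= \int[eta]_x `|u x - phi x|)%R by exact: Rintegral_ge0.
move: uphi; rewrite /L1_dist => uphi.
have nuphi := rP _ Wnu.
move: dual; rewrite affine affinef.
rewrite /muk in dmuk I1 uphi *.
rewrite !Rintegral_distribution// in dmuk uphi I1 nuphi *.
move=> dual; apply: (lsc_estimate (ltW M_gt0) (expR_ge0 M) dual nuphi dmuk uphi I1 I2 deta).
by rewrite -/K /e' mulrC divfK// gt_eqF.
Qed.

End WassersteinConvergence.

(** * Finiteness of the Wasserstein distance *)

Section FiniteWasserstein.
Context d (R : realType) (E : polishType d R) (o : E).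

Definition tuple_moment n (x : n.-tuple E) : R := (\sum_(i < n) mdist o (tnth x i) ^+ 2)%R.

Lemma tuple_moment_ge0 n (x : n.-tuple E) : (0 <= tuple_moment x)%R.
Proof. by apply: sumr_ge0 => i _; exact: sqr_ge0. Qed.

Lemma measurable_mdist2 : measurable_fun setT (fun x : E => mdist o x ^+ 2)%R.
Proof. by apply: measurable_funX; exact: measurable_mdist_to. Qed.

Lemma measurable_tuple_moment n : measurable_fun setT (@tuple_moment n).
Proof.
apply: (@measurable_sum _ _ _ _ _ _ (fun (i : 'I_n) (x : n.-tuple E) =>
  mdist o (tnth x i) ^+ 2)%R) => i.
exact: (measurableT_comp measurable_mdist2 (measurable_tnth i)).
Qed.

Lemma tuple_cost_le n (x y : n.-tuple E) :
  (tuple_cost x y <= 2 * tuple_moment x + 2 * tuple_moment y)%R.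
Proof.
rewrite /tuple_cost /tuple_moment !mulr_sumr -big_split/=; apply: ler_sum => i _.
have := metric_triangle (tnth x i) o (tnth y i); rewrite (metric_sym (tnth x i) o).
have := mdist_ge0 (tnth x i) (tnth y i).
move: (mdist (tnth x i) (tnth y i)) (mdist o (tnth x i)) (mdist o (tnth y i)).
move=> a b c a0 abc.
have h : (a ^+ 2 <= (b + c) ^+ 2)%R by apply: lerXn2r; rewrite ?nnegrE// (le_trans a0 abc).
have := sqr_ge0 (b - c)%R; rewrite sqrrB; move: h; rewrite sqrrD.
lra.
Qed.

Lemma ge0_coupling_fst n (mu nu : probability (n.-tuple E) R) pi
    (f : n.-tuple E -> \bar R) :
  coupling mu nu pi -> measurable_fun setT f -> (forall x, 0 <= f x) ->
  \int[mu]_x f x = \int[pi]_z f z.1.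
Proof.
move=> cpi mf f0; rewrite -(@ge0_integral_distribution _ _ _ _ _ pi
  (@fst _ _ : {mfun (n.-tuple E * n.-tuple E)%type >-> n.-tuple E}) f)//.
apply: eq_measure_integral => A mA _; have [h _] := cpi A mA; apply: (etrans (esym h)).
by congr (pi _); apply/seteqP; split => x; rewrite /setX /=; tauto.
Qed.

Lemma ge0_coupling_snd n (mu nu : probability (n.-tuple E) R) pi
    (f : n.-tuple E -> \bar R) :
  coupling mu nu pi -> measurable_fun setT f -> (forall x, 0 <= f x) ->
  \int[nu]_x f x = \int[pi]_z f z.2.
Proof.
move=> cpi mf f0; rewrite -(@ge0_integral_distribution _ _ _ _ _ pi
  (@snd _ _ : {mfun (n.-tuple E * n.-tuple E)%type >-> n.-tuple E}) f)//.
apply: eq_measure_integral => A mA _; have [_ h] := cpi A mA; apply: (etrans (esym h)).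
by congr (pi _); apply/seteqP; split => x; rewrite /setX /=; tauto.
Qed.

(** The independent coupling already has finite cost, by d(x,y)^2 <= 2 d(o,x)^2 + 2 d(o,y)^2 in each
    coordinate. *)
Lemma W2_lty n (mu nu : probability (n.-tuple E) R) :
  \int[mu]_x (tuple_moment x)%:E < +oo -> \int[nu]_x (tuple_moment x)%:E < +oo ->
  W2 mu nu < +oo.
Proof.
move=> mu_lt nu_lt.
pose pi : probability _ R := (mu \x nu).
have cpi : coupling mu nu pi.
  move=> A mA; split; rewrite /pi /= product_measure1E//.
    by rewrite [X in _ * X]probability_setT mule1.
  by rewrite [X in X * _]probability_setT mul1e.
apply: (@le_lt_trans _ _ (poweR (\int[pi]_z (tuple_cost z.1 z.2)%:E) 2^-1)).
  by apply: ereal_inf_lbound; exists pi.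
apply: poweR_lty.
have mm : measurable_fun setT (fun x : n.-tuple E => (2 * tuple_moment x)%:E).
  by apply/measurable_EFinP; apply: measurable_funM => //; exact: measurable_tuple_moment.
have m0 (x : n.-tuple E) : 0 <= (2 * tuple_moment x)%:E.
  by rewrite lee_fin mulr_ge0// tuple_moment_ge0.
apply: (@le_lt_trans _ _ (\int[pi]_z ((2 * tuple_moment z.1)%:E + (2 * tuple_moment z.2)%:E))).
  apply: ge0_le_integral => //.
  - by move=> z _; rewrite lee_fin tuple_cost_ge0.
  - by apply/measurable_EFinP; exact: measurable_tuple_cost.
  - apply: emeasurable_funD.
      exact: (measurableT_comp mm measurable_fst).
    exact: (measurableT_comp mm measurable_snd).
  - by move=> z _; rewrite -EFinD lee_fin; exact: tuple_cost_le.
rewrite ge0_integralD//; last 2 first.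
- exact: (measurableT_comp mm measurable_fst).
- exact: (measurableT_comp mm measurable_snd).
rewrite -(ge0_coupling_fst cpi mm m0) -(ge0_coupling_snd cpi mm m0).
have dbl (m : probability (n.-tuple E) R) : \int[m]_x (tuple_moment x)%:E < +oo ->
    \int[m]_x (2 * tuple_moment x)%:E < +oo.
  move=> h; under eq_integral do rewrite EFinM.
  rewrite ge0_integralZl//; last 2 first.
  - by apply/measurable_EFinP; exact: measurable_tuple_moment.
  - by move=> x _; rewrite lee_fin tuple_moment_ge0.
  by apply: lte_mul_pinfty.
by apply: lte_add_pinfty; exact: dbl.
Qed.

Lemma product_power_moment_lty (mu : probability E R) n : P2 o mu ->
  \int[product_power mu n]_x (tuple_moment x)%:E < +oo.
Proof.
move=> mu2; elim: n => [|n IH].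
  rewrite integral0_eq ?ltry// => x _; by rewrite /tuple_moment big_ord0.
rewrite ge0_integral_product_powerS; last 2 first.
- by apply/measurable_EFinP; exact: measurable_tuple_moment.
- by move=> x; rewrite lee_fin tuple_moment_ge0.
have tS x (y : n.-tuple E) :
    (tuple_moment (tuple_cons (x, y)))%:E = (mdist o x ^+ 2)%:E + (tuple_moment y)%:E.
  rewrite -EFinD /tuple_moment big_ord_recl; congr (_ + _)%:E.
  by apply: eq_bigr => i _; rewrite tnthS.
under eq_integral => x _.
  under eq_integral => y _ do rewrite tS.
  rewrite ge0_integralD//; last 3 first.
  - by move=> y _; rewrite lee_fin sqr_ge0.
  - by move=> y _; rewrite lee_fin tuple_moment_ge0.
  - by apply/measurable_EFinP; exact: measurable_tuple_moment.
  rewrite integral_prob_cst; over.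
rewrite ge0_integralD//; last 3 first.
- by move=> x _; rewrite lee_fin sqr_ge0.
- by apply/measurable_EFinP; exact: measurable_mdist2.
- by move=> x _; apply: integral_ge0 => y _; rewrite lee_fin tuple_moment_ge0.
by rewrite integral_prob_cst; exact: lte_add_pinfty.
Qed.

Lemma marginal_moment_lty n (mu : probability (n.-tuple E) R) :
  (forall i : 'I_n, P2 o (distribution mu (Defs.coord i))) ->
  \int[mu]_x (tuple_moment x)%:E < +oo.
Proof.
move=> H; rewrite /tuple_moment; under eq_integral do rewrite -sumEFin.
have mi (i : 'I_n) : measurable_fun setT (fun x : n.-tuple E => (mdist o (tnth x i) ^+ 2)%:E).
  apply/measurable_EFinP.
  exact: (measurableT_comp measurable_mdist2 (measurable_tnth i)).
rewrite ge0_integral_sum//; last by move=> i x _; rewrite lee_fin sqr_ge0.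
apply: lte_sum_pinfty => i _; have := H i; rewrite /P2 /second_moment.
rewrite ge0_integral_distribution//.
- by apply/measurable_EFinP; exact: measurable_mdist2.
- by move=> x; rewrite lee_fin sqr_ge0.
Qed.

End FiniteWasserstein.

(** * Restarting the particle system at a later time *)

Section Shift.
Context (R : realType) d (Omega : measurableType d) (P : probability Omega R).
Context d' (E : polishType d' R) (o : E).

(** The hypotheses on entropy and distance quantify over all realisations, so they apply to the
    restarted process, whose initial law is that of X at time s. Time-homogeneity shows in the same
    kernels [p] serving both. *)
Lemma particle_system_shift N (p : R -> R.-pker (N.-tuple E) ~> (N.-tuple E))
    (X : R -> {RV P >-> N.-tuple E}) (s : R) : (0 <= s)%R ->
  particle_system o p X -> particle_system o p (fun t => X (s + t)%R).
Proof.
move=> s0 [mX cX mom ex]; split.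
- move=> u t F A u0 t0 HF mA; rewrite addrA; apply: mX => //; first exact: addr_ge0.
  (* The past of the shifted process up to u lies in the past of X up to s + u, as generators are
     sent to generators. *)
  move: F HF; apply: sub_sigma_algebra2.
  move=> _ [v [B [/andP[v0 vu] mB ->]]]; exists (s + v)%R, B; split => //.
  by rewrite addr_ge0//= lerD2l.
- move=> w i; apply/(@subspace_continuousP R `[0%R, +oo[%classic E
    (fun t => tnth (X (s + t)%R w) i)) => x; rewrite /= in_itv /= andbT => x0.
  have /subspace_continuousP/(_ (s + x)%R) := cX w i.
  rewrite /= in_itv /= andbT addr_ge0// => /(_ isT) cv U /cv.
  rewrite /within /= => H.
  have sc : (s + t)%R @[t --> x] --> (s + x)%R by apply: cvgD; [exact: cvg_cst|exact: cvg_id].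
  have H' : nbhs (s + x)%R
      [set t : R | `[0%R, +oo[%classic t -> U (tnth (X t w) i)] by exact: H.
  suff : nbhs x [set t : R | `[0%R, +oo[%classic t -> U (tnth (X (s + t)%R w) i)] by [].
  have H2 : nbhs x [set t : R | `[0%R, +oo[%classic (s + t)%R ->
      U (tnth (X (s + t)%R w) i)] by exact: sc _ H'.
  apply: filterS H2 => t /= h; rewrite in_itv /= andbT => t0.
  by apply: h; rewrite in_itv /= andbT addr_ge0.
- by move=> t i t0; apply: mom; exact: addr_ge0.
- by move=> t t0; apply: ex; exact: addr_ge0.
Qed.

End Shift.

Lemma W2_ge0 d (R : realType) (E : polishType d R) n
  (mu nu : probability (n.-tuple E) R) : 0 <= W2 mu nu.
Proof.
rewrite leNgt; apply/negP => /ereal_inf_lt[_ [pi _ <-]].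
by apply/negP; rewrite -leNgt poweR_ge0.
Qed.

(* [N %/ k] disjoint blocks fit into [N] coordinates, and [N <= 2 k (N %/ k)]. *)
Lemma exchangeable_relative_entropy_first_coords d (T : measurableType d) (R : realType)
    N k (le_kN : (k <= N)%N) (nu : probability (N.-tuple T) R) (mu : probability T R) :
  exchangeable nu -> (0 < k)%N ->
  relative_entropy (distribution nu (first_coords le_kN)) (product_power mu k)
    <= (2 * (k%:R / N%:R))%R%:E * relative_entropy nu (product_power mu N).
Proof.
move=> ex k0; have N0 : (0 < N)%N := leq_trans k0 le_kN.
have m0 : (0 < N %/ k)%N by rewrite divn_gt0.
have NR : (0 < N%:R :> R)%R by rewrite ltr0n.
have kR : (0 < k%:R :> R)%R by rewrite ltr0n.
have c0 : (0 <= 2 * (k%:R / N%:R) :> R)%R by rewrite mulr_ge0// divr_ge0// ltW.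
have := exchangeable_relative_entropy_marginal le_kN mu ex m0 (leq_divM N k).
move=> /(lee_wpmul2l (x := (2 * (k%:R / N%:R))%R%:E)) => /(_ (ltac:(by rewrite lee_fin))).
apply: le_trans; rewrite muleA -EFinM.
rewrite -[leLHS]mul1e lee_wpmul2r ?relative_entropy_ge0// lee_fin.
rewrite mulrA mulrAC -mulrA mulrA ler_pdivlMr// mul1r.
rewrite -!natrM ler_nat.
rewrite mulnAC mul2n -addnn mulnDl (leq_trans (ltnW (ltn_ceil N k0)))// mulSn.
by rewrite leq_add2r leq_pmull.
Qed.

Section Coefficients.
Variable R : realType.

Lemma coef_dist_le (A B q u v : R) : (0 <= B)%R -> (0 <= q)%R -> (0 <= u * v)%R ->
  (2 * q * (A * u * v) <= 2 * (A + B) * q * u * v)%R.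
Proof. by move=> B0 q0 uv0; have := mulr_ge0 (mulr_ge0 B0 q0) uv0; lra. Qed.

Lemma coef_moment_le (A B q s : R) : (0 <= A)%R -> (0 <= q)%R -> (0 <= s)%R ->
  (2 * q * (B * s) <= 2 * (A + B) * s * q)%R.
Proof. by move=> A0 q0 s0; have := mulr_ge0 (mulr_ge0 A0 q0) s0; lra. Qed.

End Coefficients.

(** * From the two estimates on the particle system to the three assertions *)

Section PropagationOfChaos.
Context (R : realType) (d : measure_display) (E : polishType d R) (o : E).
Variables (p : forall N : nat, R -> R.-pker (N.-tuple E) ~> (N.-tuple E)).
Variables (Pstar : R -> probability E R -> probability E R).
Hypothesis Pstar_semigroup : P2_semigroup o Pstar.
Variables (t0 r0 c : R) (g h : R -> R).
Hypotheses (r0_ge0 : (0 <= r0)%R) (r0_lt_t0 : (r0 < t0)%R) (c_gt0 : (0 < c)%R).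
Hypothesis g_gt0 : forall t : R, (0 <= t)%R -> (0 < g t)%R.
Hypothesis h_gt0 : forall t : R, (r0 < t <= t0)%R -> (0 < h t)%R.
Hypothesis entropy_bound :
    forall (N : nat) (d' : measure_display) (Omega : measurableType d')
      (P : probability Omega R) (X : R -> {RV P >-> N.-tuple E})
      (mu : probability E R) (t : R),
    (1 <= N)%N -> particle_system o (p N) X -> P2 o mu -> (r0 < t <= t0)%R ->
    relative_entropy (distribution P (X t)) (product_power (Pstar t mu) N)
      <= (h t)%:E * W2 (distribution P (X 0%R)) (product_power mu N) ^+ 2
         + c%:E * (1 + second_moment o mu).
Hypothesis wasserstein_bound :
    forall (N : nat) (d' : measure_display) (Omega : measurableType d')
      (P : probability Omega R) (X : R -> {RV P >-> N.-tuple E})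
      (mu : probability E R) (t : R),
    (1 <= N)%N -> particle_system o (p N) X -> P2 o mu -> (0 <= t)%R ->
    W2 (distribution P (X t)) (product_power (Pstar t mu) N) ^+ 2
      <= (g t)%:E * W2 (distribution P (X 0%R)) (product_power mu N) ^+ 2
         + c%:E * (1 + second_moment o mu).
Hypothesis moment_bound :
    forall mu : probability E R, P2 o mu ->
    ereal_sup [set \int[Pstar t mu]_x (1 + (mdist o x) ^+ 2)%R%:E
              | t in [set t : R | (0 <= t)%R]]
      <= c%:E * (1 + second_moment o mu).

(** For t <= t0 the target carries a factor g(0) that the entropy hypothesis does not have; the
    summand 1/g(0) of [A] cancels it, while the 1 serves t > t0. In [B], c serves t <= t0; for t >
    t0, h(t0) c is the additive term of the Wasserstein estimate passed through the entropy
    estimate, and c c comes from the moment of [Pstar (t - t0) mu]. *)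
Let A : R := (1 + (g 0)^-1)%R.
Let B : R := (c + h t0 * c + c * c)%R.

Let t0_in : (r0 < t0 <= t0)%R. Proof. by rewrite r0_lt_t0 lexx. Qed.
Let g0_gt0 : (0 < g 0)%R. Proof. exact: g_gt0. Qed.
Let h0_gt0 : (0 < h t0)%R. Proof. exact: h_gt0. Qed.

Let A_ge1 : (1 <= A)%R. Proof. by rewrite /A lerDl invr_ge0 ltW. Qed.
Let B_gec : (c <= B)%R.
Proof. by rewrite /B -addrA lerDl addr_ge0 ?mulr_ge0// ltW. Qed.

Lemma P2_second_moment (mu : probability E R) : P2 o mu ->
  exists2 s : R, (0 <= s)%R & 1 + second_moment o mu = (1 + s)%:E.
Proof.
rewrite /P2; have : 0 <= second_moment o mu.
  by apply: integral_ge0 => x _; rewrite lee_fin sqr_ge0.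
by case: (second_moment o mu) => [s| |]//= s0 _; exists s; rewrite ?EFinD.
Qed.

Lemma second_moment_Pstar (mu : probability E R) s : P2 o mu -> (0 <= s)%R ->
  1 + second_moment o (Pstar s mu) <= c%:E * (1 + second_moment o mu).
Proof.
move=> mu2 s0; apply: le_trans (moment_bound mu2).
suff -> : 1 + second_moment o (Pstar s mu) =
    \int[Pstar s mu]_x (1 + (mdist o x) ^+ 2)%R%:E.
  by apply: ereal_sup_ubound; exists s.
under eq_integral do rewrite EFinD.
rewrite ge0_integralD//; last 2 first.
- by move=> x _; rewrite lee_fin sqr_ge0.
- by apply/measurable_EFinP; exact: measurable_mdist2.
by rewrite integral_prob_cst.
Qed.

(* For [t > t0], run the entropy estimate over the last [t0] units of time, its
   initial distance being controlled by the Wasserstein estimate. *)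
Lemma relative_entropy_system N d' (Omega : measurableType d')
    (P : probability Omega R) (X : R -> {RV P >-> N.-tuple E})
    (mu : probability E R) (t : R) :
  (1 <= N)%N -> particle_system o (p N) X -> P2 o mu -> (r0 < t)%R ->
  relative_entropy (distribution P (X t)) (product_power (Pstar t mu) N)
    <= (A * g (Num.max (t - t0) 0) * h (Num.min t t0))%R%:E
         * W2 (distribution P (X 0%R)) (product_power mu N) ^+ 2
       + B%:E * (1 + second_moment o mu).
Proof.
move=> N1 pX mu2 r0t.
have [s s0 sE] := P2_second_moment mu2.
have W0 : 0 <= W2 (distribution P (X 0%R)) (product_power mu N) ^+ 2.
  by apply: expe_ge0; exact: W2_ge0.
have s1 : (0 <= 1 + s)%R by rewrite addr_ge0.
have [tt0|t0t] := leP t t0.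
  have tin : (r0 < t <= t0)%R by rewrite r0t tt0.
  apply: (le_trans (entropy_bound N1 pX mu2 tin)).
  rewrite (max_r (_ : t - t0 <= 0)%R) ?subr_le0// sE; apply: leeD.
    rewrite lee_wpmul2r// lee_fin mulrDl mul1r mulVf ?gt_eqF//.
    by rewrite ler_peMl ?(ltW (h_gt0 tin))// lerDr ltW.
  by rewrite -!EFinM lee_fin ler_wpM2r.
have u0 : (0 <= t - t0)%R by rewrite subr_ge0 ltW.
rewrite max_l//.
have [P2P _ Psem] := Pstar_semigroup.
have ent := entropy_bound N1 (particle_system_shift u0 pX) (P2P _ _ u0 mu2) t0_in.
rewrite addr0 subrK in ent.
have t0_ge0 : (0 <= t0)%R by rewrite (le_trans r0_ge0)// ltW.
have eqm : Defs.eq_measure (product_power (Pstar t mu) N)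
    (product_power (Pstar t0 (Pstar (t - t0)%R mu)) N).
  apply: eq_measure_product_power; apply: eq_measure_sym.
  by have := Psem t0 (t - t0)%R mu t0_ge0 u0 mu2; rewrite (addrC t0) subrK.
apply: (le_trans (relative_entropy_le_eq_measure (fun _ _ => erefl) eqm)).
apply: (le_trans ent).
have mb := second_moment_Pstar mu2 u0.
have wb := wasserstein_bound N1 pX mu2 u0.
rewrite sE in mb wb *.
apply: (@le_trans _ _ ((h t0)%:E * ((g (t - t0))%:E * W2 (distribution P (X 0%R))
    (product_power mu N) ^+ 2 + c%:E * (1 + s)%:E) + c%:E * (c%:E * (1 + s)%:E))).
  by apply: leeD; rewrite lee_wpmul2l// lee_fin ltW.
rewrite ge0_muleDr; last 2 first.
- by rewrite mule_ge0// lee_fin ltW// g_gt0.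
- by rewrite -EFinM lee_fin mulr_ge0// ltW.
rewrite -addeA muleA -!EFinM -EFinD; apply: leeD.
  rewrite lee_wpmul2r// lee_fin mulrC -mulrA ler_peMl// mulr_ge0// ltW//.
  exact: g_gt0.
by rewrite lee_fin !mulrA -mulrDl ler_wpM2r// /B -addrA lerDr ltW.
Qed.

(** The 2 is the loss in replacing N/k by its integer part; the sum is one constant dominating both
    coefficients. *)
Let ct : R := (2 * (A + B))%R.

Let ct_gt0 : (0 < ct)%R.
Proof.
rewrite /ct mulr_gt0// addr_gt0//; first exact: lt_le_trans ltr01 A_ge1.
exact: lt_le_trans c_gt0 B_gec.
Qed.

Let gh_gt0 t : (r0 < t)%R -> (0 < g (Num.max (t - t0) 0) * h (Num.min t t0))%R.
Proof.
move=> r0t; rewrite mulr_gt0//; first by rewrite g_gt0// le_max lexx orbT.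
by apply: h_gt0; rewrite lt_min r0t r0_lt_t0 ge_min lexx orbT.
Qed.

Lemma relative_entropy_marginal N k (le_kN : (k <= N)%N) d' (Omega : measurableType d')
    (P : probability Omega R) (X : R -> {RV P >-> N.-tuple E})
    (mu : probability E R) (t : R) :
  (1 <= k)%N -> particle_system o (p N) X -> P2 o mu -> (r0 < t)%R ->
  relative_entropy (distribution (distribution P (X t)) (first_coords le_kN))
      (product_power (Pstar t mu) k)
    <= (ct * (k%:R / N%:R) * g (Num.max (t - t0) 0) * h (Num.min t t0))%R%:E
         * W2 (distribution P (X 0%R)) (product_power mu N) ^+ 2
       + ct%:E * (1 + second_moment o mu) * (k%:R / N%:R)%R%:E.
Proof.
move=> k1 pX mu2 r0t; have N1 : (1 <= N)%N := leq_trans k1 le_kN.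
have [s s0 sE] := P2_second_moment mu2.
have ex : exchangeable (distribution P (X t)).
  by have [_ _ _] := pX; apply; rewrite (le_trans r0_ge0)// ltW.
apply: (le_trans (exchangeable_relative_entropy_first_coords le_kN (Pstar t mu) ex k1)).
have q0 : (0 <= k%:R / N%:R :> R)%R by rewrite divr_ge0.
have W0 : 0 <= W2 (distribution P (X 0%R)) (product_power mu N) ^+ 2.
  by apply: expe_ge0; exact: W2_ge0.
have gh := gh_gt0 r0t.
have A0 : (0 <= A)%R := le_trans ler01 A_ge1.
have B0 : (0 <= B)%R := le_trans (ltW c_gt0) B_gec.
apply: (@le_trans _ _ ((2 * (k%:R / N%:R))%R%:E *
  ((A * g (Num.max (t - t0) 0) * h (Num.min t t0))%R%:E
     * W2 (distribution P (X 0%R)) (product_power mu N) ^+ 2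
   + B%:E * (1 + second_moment o mu)))).
  rewrite lee_wpmul2l ?lee_fin ?mulr_ge0//.
  exact: relative_entropy_system.
rewrite sE ge0_muleDr; last 2 first.
- by rewrite mule_ge0// lee_fin -mulrA mulr_ge0// ltW.
- by rewrite -EFinM lee_fin mulr_ge0// addr_ge0.
rewrite muleA -!EFinM; apply: leeD.
  by rewrite lee_wpmul2r// lee_fin; apply: coef_dist_le => //; exact: ltW gh.
by rewrite lee_fin; apply: coef_moment_le => //; exact: addr_ge0.
Qed.

Lemma relative_entropy_marginal_invariant (mustar : probability E R) N k
    (le_kN : (k <= N)%N) d' (Omega : measurableType d')
    (P : probability Omega R) (X : R -> {RV P >-> N.-tuple E}) (t : R) :
  invariant_measure o Pstar mustar ->
  (1 <= k)%N -> particle_system o (p N) X -> (r0 < t)%R ->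
  relative_entropy (distribution (distribution P (X t)) (first_coords le_kN))
      (product_power mustar k)
    <= (ct * (k%:R / N%:R) * g (Num.max (t - t0) 0) * h (Num.min t t0))%R%:E
         * W2 (distribution P (X 0%R)) (product_power mustar N) ^+ 2
       + ct%:E * (1 + second_moment o mustar) * (k%:R / N%:R)%R%:E.
Proof.
move=> [mu2 inv] k1 pX r0t; have t_ge0 : (0 <= t)%R by rewrite (le_trans r0_ge0)// ltW.
apply: le_trans (relative_entropy_marginal le_kN k1 pX mu2 r0t).
apply: relative_entropy_le_eq_measure => //.
by apply: eq_measure_product_power; apply: eq_measure_sym; exact: inv.
Qed.

(** For t >= t0 the bound with the invariant measure is a constant L plus K g(t - t0), K being
    finite as the initial distance is. At late times the law of X thus has marginal entropy below
    any L' > L and is W2-close to [mubar], as lower semicontinuity requires. *)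
Lemma relative_entropy_marginal_limit (g_lim : g t @[t --> +oo%R] --> 0%R)
    (mustar : probability E R) N k (le_kN : (k <= N)%N) d' (Omega : measurableType d')
    (P : probability Omega R) (X : R -> {RV P >-> N.-tuple E})
    (mubar : probability (N.-tuple E) R) :
  invariant_measure o Pstar mustar ->
  (1 <= k)%N -> particle_system o (p N) X ->
  W2 (distribution P (X t)) mubar @[t --> +oo%R] --> 0 ->
  relative_entropy (distribution mubar (first_coords le_kN)) (product_power mustar k)
    <= ct%:E * (1 + second_moment o mustar) * (k%:R / N%:R)%R%:E.
Proof.
move=> inv k1 pX WX; have [mu2 _] := inv.
have [s s0 sE] := P2_second_moment mu2.
rewrite sE -!EFinM; apply: relative_entropy_lsc => r L' r_gt0 LL'.
have W_fin : W2 (distribution P (X 0%R)) (product_power mustar N) < +oo.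
  apply: (W2_lty (o := o)); last exact: product_power_moment_lty.
  by apply: marginal_moment_lty => i; have [_ _ + _] := pX; apply.
have W_ge0 := W2_ge0 (distribution P (X 0%R)) (product_power mustar N).
have [w w0 wE] : exists2 w : R, (0 <= w)%R &
    W2 (distribution P (X 0%R)) (product_power mustar N) ^+ 2 = w%:E.
  case: (W2 _ _) W_fin W_ge0 => [w| |]// _ _.
  by exists (w ^+ 2)%R; [exact: sqr_ge0|rewrite EFin_expe].
pose K := (ct * (k%:R / N%:R) * h t0 * w)%R.
have K0 : (0 <= K)%R.
  by rewrite /K mulr_ge0// mulr_ge0 ?(ltW h0_gt0)// mulr_ge0 ?(ltW ct_gt0)// divr_ge0.
set L := (ct * (1 + s) * (k%:R / N%:R))%R in LL' *.
(* Chosen so that K eta <= L' - L; the added 1 covers K = 0. *)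
pose eta := ((L' - L) / (K + 1))%R.
have eta0 : (0 < eta)%R by rewrite divr_gt0 ?subr_gt0// ltr_wpDl.
have /cvgrPdist_lt/(_ _ eta0)[T1 [_ T1P]] := g_lim.
have nbhs_r : nbhs (0 : \bar R) [set x | x < r%:E].
  by apply: open_nbhs_nbhs; split; [exact: open_ereal_lt_ereal|rewrite /= lte_fin].
have [T2 [_ T2P]] : \forall t \near +oo%R, W2 (distribution P (X t)) mubar < r%:E.
  exact: WX _ nbhs_r.
(* One time beyond all thresholds: t - t0 exceeds T1, while t exceeds T2 and t0. *)
pose t := (`|T1| + `|T2| + t0 + 1)%R.
have tT1 : (T1 < t - t0)%R.
  by rewrite /t; have := ler_norm T1; have := normr_ge0 T2; lra.
have t0_gt0 : (0 < t0)%R := le_lt_trans r0_ge0 r0_lt_t0.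
have tT2 : (T2 < t)%R.
  by rewrite /t; have := ler_norm T2; have := normr_ge0 T1; lra.
have t0t : (t0 <= t)%R.
  by rewrite /t; have := normr_ge0 T2; have := normr_ge0 T1; lra.
exists (distribution P (X t)); first exact: T2P.
apply: (le_trans (relative_entropy_marginal_invariant le_kN inv k1 pX
  (lt_le_trans r0_lt_t0 t0t))).
rewrite wE sE -!EFinM -EFinD lee_fin -/L max_l ?subr_ge0// min_r//.
have := T1P _ tT1; rewrite sub0r normrN => /(le_lt_trans (ler_norm _)) gt.
have -> : (ct * (k%:R / N%:R) * g (t - t0) * h t0 * w = K * g (t - t0))%R.
  by rewrite /K; ring.
rewrite -lerBrDr; apply: (@le_trans _ _ (K * eta)%R); first by rewrite ler_wpM2l// ltW.
rewrite /eta mulrCA ler_piMr ?subr_ge0 ?(ltW LL')//.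
by rewrite ler_pdivrMr ?ltr_wpDl// mul1r lerDl.
Qed.

Lemma relative_entropy_constant_gt0 : (0 < ct)%R.
Proof. exact: ct_gt0. Qed.

End PropagationOfChaos.

Theorem theorem2p1 (R : realType) (d : measure_display) (E : polishType d R) (o : E)
  (p : forall N : nat, R -> R.-pker (N.-tuple E) ~> (N.-tuple E))
  (p_semigroup : forall N : nat, (1 <= N)%N -> transition_semigroup (p N))
  (Pstar : R -> probability E R -> probability E R)
  (Pstar_semigroup : P2_semigroup o Pstar)
  (t0 r0 c : R) (g h : R -> R)
  (r0_ge0 : (0 <= r0)%R) (r0_lt_t0 : (r0 < t0)%R) (c_gt0 : (0 < c)%R)
  (g_gt0 : forall t : R, (0 <= t)%R -> (0 < g t)%R)
  (g_cont : {within `[0%R, +oo[, continuous g})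
  (g_lim : g t @[t --> +oo%R] --> 0%R)
  (h_gt0 : forall t : R, (r0 < t <= t0)%R -> (0 < h t)%R)
  (h_cont : {within `]r0, t0], continuous h})
  (h_lim : h t @[t --> r0^'+] --> +oo%R)
  (entropy_bound :
    forall (N : nat) (d' : measure_display) (Omega : measurableType d')
      (P : probability Omega R) (X : R -> {RV P >-> N.-tuple E})
      (mu : probability E R) (t : R),
    (1 <= N)%N -> particle_system o (p N) X -> P2 o mu -> (r0 < t <= t0)%R ->
    relative_entropy (distribution P (X t)) (product_power (Pstar t mu) N)
      <= (h t)%:E * W2 (distribution P (X 0%R)) (product_power mu N) ^+ 2
         + c%:E * (1 + second_moment o mu))
  (wasserstein_bound :
    forall (N : nat) (d' : measure_display) (Omega : measurableType d')
      (P : probability Omega R) (X : R -> {RV P >-> N.-tuple E})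
      (mu : probability E R) (t : R),
    (1 <= N)%N -> particle_system o (p N) X -> P2 o mu -> (0 <= t)%R ->
    W2 (distribution P (X t)) (product_power (Pstar t mu) N) ^+ 2
      <= (g t)%:E * W2 (distribution P (X 0%R)) (product_power mu N) ^+ 2
         + c%:E * (1 + second_moment o mu))
  (moment_bound :
    forall mu : probability E R, P2 o mu ->
    ereal_sup [set \int[Pstar t mu]_x (1 + (mdist o x) ^+ 2)%R%:E
              | t in [set t : R | (0 <= t)%R]]
      <= c%:E * (1 + second_moment o mu)) :
  exists ctilde : R, [/\ (0 < ctilde)%R,
    (* (i) *)
    (forall (N k : nat) (le_kN : (k <= N)%N)
       (d' : measure_display) (Omega : measurableType d')
       (P : probability Omega R) (X : R -> {RV P >-> N.-tuple E})
       (mu : probability E R) (t : R),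
     (1 <= k)%N -> particle_system o (p N) X -> P2 o mu -> (r0 < t)%R ->
     relative_entropy
         (distribution (distribution P (X t)) (first_coords le_kN))
         (product_power (Pstar t mu) k)
       <= (ctilde * (k%:R / N%:R)
             * g (Num.max (t - t0) 0) * h (Num.min t t0))%R%:E
            * W2 (distribution P (X 0%R)) (product_power mu N) ^+ 2
          + ctilde%:E * (1 + second_moment o mu) * (k%:R / N%:R)%R%:E),
    (* (ii) *)
    (forall (mustar : probability E R),
     unique_invariant_measure o Pstar mustar ->
     forall (N k : nat) (le_kN : (k <= N)%N)
       (d' : measure_display) (Omega : measurableType d')
       (P : probability Omega R) (X : R -> {RV P >-> N.-tuple E}) (t : R),
     (1 <= k)%N -> particle_system o (p N) X -> (r0 < t)%R ->
     relative_entropy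
         (distribution (distribution P (X t)) (first_coords le_kN))
         (product_power mustar k)
       <= (ctilde * (k%:R / N%:R)
             * g (Num.max (t - t0) 0) * h (Num.min t t0))%R%:E
            * W2 (distribution P (X 0%R)) (product_power mustar N) ^+ 2
          + ctilde%:E * (1 + second_moment o mustar) * (k%:R / N%:R)%R%:E) &
    (* (iii) *)
    (forall (mustar : probability E R),
     unique_invariant_measure o Pstar mustar ->
     forall (N k : nat) (le_kN : (k <= N)%N)
       (d' : measure_display) (Omega : measurableType d')
       (P : probability Omega R) (X : R -> {RV P >-> N.-tuple E})
       (mubar : probability (N.-tuple E) R),
     (1 <= k)%N -> particle_system o (p N) X -> P2_tuple o mubar ->
     W2 (distribution P (X t)) mubar @[t --> +oo%R] --> 0 ->
     relative_entropy (distribution mubar (first_coords le_kN))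
         (product_power mustar k)
       <= ctilde%:E * (1 + second_moment o mustar) * (k%:R / N%:R)%R%:E)].
Proof.
(* This is [ct] with the local definitions [A] and [B] unfolded; it depends only on c, g(0) and
   h(t0). *)
exists (2 * ((1 + (g 0)^-1) + (c + h t0 * c + c * c)))%R; split.
- exact: (relative_entropy_constant_gt0 r0_lt_t0 c_gt0 g_gt0 h_gt0).
- move=> N k le_kN d' Omega P X mu t k1 pX mu2 r0t.
  exact: (relative_entropy_marginal Pstar_semigroup r0_ge0 r0_lt_t0 c_gt0 g_gt0 h_gt0
    entropy_bound wasserstein_bound moment_bound).
- move=> mustar [inv _] N k le_kN d' Omega P X t k1 pX r0t.
  exact: (relative_entropy_marginal_invariant Pstar_semigroup r0_ge0 r0_lt_t0 c_gt0
    g_gt0 h_gt0 entropy_bound wasserstein_bound moment_bound).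
- move=> mustar [inv _] N k le_kN d' Omega P X mubar k1 pX _ WX.
  exact: (relative_entropy_marginal_limit Pstar_semigroup r0_ge0 r0_lt_t0 c_gt0
    g_gt0 h_gt0 entropy_bound wasserstein_bound moment_bound g_lim le_kN inv k1 pX WX).
Qed.
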